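(* Let $(M,\varphi,\xi,\eta,g)$ be an $\eta$-Einstein Kenmotsu manifold of dimension $2n+1>3$. If $g$ is a $*$-Ricci soliton, i.e. there are a vector field $V$ on $M$ and a constant $\lambda\in\mathbb{R}$ with $\pounds_V g+2S^*+2\lambda g=0$, then $M$ is Einstein.
   Context: All manifolds, tensors and functions are smooth; $\mathfrak{X}(M)$ denotes the vector fields on $M$; $\pounds$ is the Lie derivative; $\nabla$ is the Levi-Civita connection of $g$. An almost contact metric manifold $(M,\varphi,\xi,\eta,g)$ of dimension $2n+1$ ($n\ge 1$) is a smooth manifold with a $(1,1)$-tensor field $\varphi$, a vector field $\xi$ (the characteristic vector field), a 1-form $\eta$ and a Riemannian metric $g$ such that $\varphi^2=-I+\eta\otimes\xi$, $\eta(\xi)=1$ and $g(\varphi X,\varphi Y)=g(X,Y)-\eta(X)\eta(Y)$ for all $X,Y\in\mathfrak{X}(M)$. It is called Kenmotsu if $(\nabla_X\varphi)Y=g(\varphi X,Y)\xi-\eta(Y)\varphi X$ for all $X,Y\in\mathfrak{X}(M)$. The curvature convention is $R(X,Y)=[\nabla_X,\nabla_Y]-\nabla_{[X,Y]}$; the Ricci tensor is $S(Y,Z)=\mathrm{trace}(X\mapsto R(X,Y)Z)$. The $*$-Ricci tensor is $S^*(X,Y)=\frac12\,\mathrm{trace}\big(Z\mapsto R(X,\varphi Y)\varphi Z\big)$. $M$ is $\eta$-Einstein if $S=\alpha g+\beta\,\eta\otimes\eta$ for some smooth functions $\alpha,\beta$ on $M$; $M$ is Einstein if $S=ag$ for some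 constant $a$. *)

(* Defs.v *)
(* Vector fields are the R-linear derivations of the ring C^oo(M), and tensor
   fields are C^oo(M)-multilinear maps of vector fields. *)
From HB Require Import structures.
From mathcomp Require Import all_boot all_order all_algebra.
From mathcomp Require Import all_classical all_reals all_analysis.
From mathcomp Require Import ring.

Set Implicit Arguments.
Unset Strict Implicit.
Unset Printing Implicit Defensive.

Import Order.TTheory GRing.Theory Num.Theory.
Import numFieldNormedType.Exports.

Local Open Scope classical_set_scope.
Local Open Scope ring_scope.

Section SmoothOn.
Context {R : realType} {m : nat}.
Implicit Types (U : set 'rV[R]_m) (f g : 'rV[R]_m -> R).

(* Only meaningful for U open; the values of f outside U are then irrelevant. *)
Fixpoint Ck_on (k : nat) U f : Prop :=
  (forall x, U x -> {for x, continuous f}) /\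
  if k is k'.+1 then
    forall i : 'I_m, (forall x, U x -> derivable f x (delta_mx 0 i)) /\
                     Ck_on k' U ('D_(delta_mx 0 i) f)
  else True.

Definition smooth_on U f : Prop := forall k, Ck_on k U f.

Lemma Ck_on_ext k U f g : open U -> (forall x, U x -> f x = g x) ->
  Ck_on k U f -> Ck_on k U g.
Proof.
move=> oU; elim: k f g => [|k IH] f g fg /= [cf df].
all: have nfg x : U x -> \forall y \near x, f y = g y
  by move=> Ux; apply: filterS fg _; exact: open_nbhs_nbhs.
all: have cg x : U x -> {for x, continuous g}.
1,3: move=> Ux; have := cf x Ux; rewrite /prop_for /continuous_at (fg x Ux).
1,2: by apply: cvg_trans; apply: (near_eq_cvg (F := nbhs x)); exact: nfg.
all: split=> // i; have [dfi Cfi] := df i.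
have ei x : U x -> 'D_(delta_mx 0 i) f x = 'D_(delta_mx 0 i) g x.
  by move=> Ux; apply: near_eq_derive; exact: nfg.
split; last exact: IH Cfi.
move=> x Ux; apply: near_eq_derivable (dfi x Ux); exact: nfg.
Qed.

Lemma Ck_onS k U f : Ck_on k.+1 U f -> Ck_on k U f.
Proof.
elim: k f => [|k IH] f [cf df]; split=> // i.
by have [dfi Cfi] := df i; split=> //; exact: IH.
Qed.

Lemma Ck_on_cst k U a : Ck_on k U (cst a).
Proof.
elim: k a => [|k IH] a /=; split=> //; try by move=> x _; exact: cst_continuous.
move=> i; split; first by move=> x _; exact: derivable_cst.
suff -> : 'D_(delta_mx 0 i) (cst a : 'rV[R]_m -> R) = cst 0 by [].
by apply/funext => x; rewrite derive_cst.
Qed.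

Lemma Ck_onB k U f g : open U -> Ck_on k U f -> Ck_on k U g ->
  Ck_on k U (f - g).
Proof.
move=> oU; elim: k f g => [|k IH] f g /= [cf df] [cg dg]; split=> //;
  try by move=> x Ux; apply: continuousB; [exact: cf|exact: cg].
move=> i; have [dfi Cfi] := df i; have [dgi Cgi] := dg i; split.
  by move=> x Ux; apply: derivableB; [exact: dfi|exact: dgi].
apply: Ck_on_ext (IH _ _ Cfi Cgi) => // x Ux.
by rewrite deriveB; [|exact: dfi|exact: dgi].
Qed.

Lemma Ck_onD k U f g : open U -> Ck_on k U f -> Ck_on k U g ->
  Ck_on k U (f + g).
Proof.
move=> oU Cf Cg; have -> : f + g = f - (cst 0 - g).
  by apply/funext => x; rewrite !fctE sub0r opprK.
by apply: Ck_onB => //; apply: Ck_onB => //; exact: Ck_on_cst.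
Qed.

Lemma Ck_onM k U f g : open U -> Ck_on k U f -> Ck_on k U g ->
  Ck_on k U (f * g).
Proof.
move=> oU; elim: k f g => [|k IH] f g Cf Cg; have [cf df] := Cf;
  have [cg dg] := Cg; split=> //;
  try by move=> x Ux; apply: continuousM; [exact: cf|exact: cg].
move=> i; have [dfi Cfi] := df i; have [dgi Cgi] := dg i; split.
  by move=> x Ux; apply: derivableM; [exact: dfi|exact: dgi].
have Ck : Ck_on k U (f * 'D_(delta_mx 0 i) g + g * 'D_(delta_mx 0 i) f).
  by apply: Ck_onD => //; apply: IH => //; exact: Ck_onS.
apply: Ck_on_ext Ck => // x Ux.
by rewrite deriveM; [|exact: dfi|exact: dgi].
Qed.

End SmoothOn.

(* chart_inv is unconstrained outside the image of the chart. *)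
Record chart (R : realType) (m : nat) (T : topologicalType) := Chart {
  chart_dom : set T;
  chart_map : T -> 'rV[R]_m;
  chart_inv : 'rV[R]_m -> T;
  chart_dom_open : open chart_dom;
  chart_img_open : open (chart_map @` chart_dom);
  chart_mapK : forall p, chart_dom p -> chart_inv (chart_map p) = p;
  chart_map_continuous : {within chart_dom, continuous chart_map};
  chart_inv_continuous : {within chart_map @` chart_dom, continuous chart_inv} }.

Definition smooth_transition (R : realType) (m : nat) (T : topologicalType)
    (c d : chart R m T) : Prop :=
  forall j : 'I_m,
    smooth_on (chart_map c @` (chart_dom c `&` chart_dom d))
              (fun x => chart_map d (chart_inv c x) 0 j).

Record manifold (R : realType) (m : nat) := Manifold {
  manifold_space :> topologicalType;
  atlas : set (chart R m manifold_space);
  manifold_hausdorff : hausdorff_space manifold_space;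
  manifold_second_countable : @second_countable manifold_space;
  atlas_cover : forall p : manifold_space, exists2 c, atlas c & chart_dom c p;
  atlas_compatible : forall c d, atlas c -> atlas d -> smooth_transition c d }.

Definition smooth (R : realType) (m : nat) (M : manifold R m)
    : {pred (M -> R)} :=
  [pred f : M -> R | `[< forall c, atlas c ->
     smooth_on (chart_map c @` chart_dom c) (f \o chart_inv c) >]].

Section SmoothClosed.
Context {R : realType} {m : nat} (M : manifold R m).

Lemma smooth_subring_closed : subring_closed (@smooth R m M).
Proof.
split.
- by apply/asboolP => c _ k; exact: Ck_on_cst.
- move=> f g /asboolP sf /asboolP sg; apply/asboolP => c ac k.
  by apply: (@Ck_onB _ _ _ _ (f \o chart_inv c) (g \o chart_inv c));
    [exact: chart_img_open|exact: sf|exact: sg].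
- move=> f g /asboolP sf /asboolP sg; apply/asboolP => c ac k.
  by apply: (@Ck_onM _ _ _ _ (f \o chart_inv c) (g \o chart_inv c));
    [exact: chart_img_open|exact: sf|exact: sg].
Qed.

Lemma smooth_cst (a : R) : cst a \in @smooth R m M.
Proof. by apply/asboolP => c _ k; exact: Ck_on_cst. Qed.

End SmoothClosed.

Record Cinf (R : realType) (m : nat) (M : manifold R m) := MkCinf {
  Cinf_fun :> M -> R;
  Cinf_smooth : Cinf_fun \in @smooth R m M }.

Section CinfRing.
Context {R : realType} {m : nat} (M : manifold R m).

HB.instance Definition _ := [isSub for @Cinf_fun R m M].
HB.instance Definition _ := [Choice of Cinf M by <:].
HB.instance Definition _ := 
  GRing.SubChoice_isSubComPzRing.Build (M -> R) (@smooth R m M) (Cinf M)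
    (smooth_subring_closed M).

Definition Cinf_cst (a : R) : Cinf M := MkCinf (smooth_cst M a).

Definition derivation : {pred (Cinf M -> (Cinf M)^o)} :=
  [pred X : Cinf M -> (Cinf M)^o | `[<
     (forall a f h, X (Cinf_cst a * f + h) = Cinf_cst a * X f + X h) /\
     (forall f h, X (f * h) = X f * h + f * X h) >]].

Lemma derivation_submod_closed : submod_closed derivation.
Proof.
split.
  apply/asboolP; split=> [a f h|f h].
    by change (0 = Cinf_cst a * 0 + 0 :> Cinf M); rewrite mulr0 addr0.
  by change (0 = 0 * h + f * 0 :> Cinf M); rewrite mulr0 mul0r addr0.
move=> k X Y /asboolP[Xl XL] /asboolP[Yl YL]; apply/asboolP.
have E f : (k *: X + Y) f = (k : Cinf M) * X f + Y f :> Cinf M by [].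
split=> [a f h|f h]; rewrite !E.
  by rewrite Xl Yl; ring.
by rewrite XL YL; ring.
Qed.

End CinfRing.

Arguments derivation {R m} M _.

Record vfield (R : realType) (m : nat) (M : manifold R m) := MkVfield {
  vfield_fun :> Cinf M -> Cinf M;
  vfield_derivation : vfield_fun \in derivation M }.

Section Calculus.
Context {R : realType} {m : nat} {M : manifold R m}.

HB.instance Definition _ := [isSub for @vfield_fun R m M].
HB.instance Definition _ := [Choice of vfield M by <:].
HB.instance Definition _ := 
  GRing.SubChoice_isSubLmodule.Build (Cinf M) (Cinf M -> (Cinf M)^o)
    (derivation M) (vfield M)
    (GRing.submod_closed_semi (derivation_submod_closed M)).


Implicit Types (X Y Z V : vfield M) (p : M).

Lemma bracket_derivation X Y :
  (fun f => X (Y f) - Y (X f)) \in derivation M.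
Proof.
have /asboolP[Xl XL] := vfield_derivation X.
have /asboolP[Yl YL] := vfield_derivation Y.
have XD f h : X (f + h) = X f + X h.
  by have := Xl 1 f h; rewrite (_ : Cinf_cst M 1 = 1) ?mul1r//; apply: val_inj.
have YD f h : Y (f + h) = Y f + Y h.
  by have := Yl 1 f h; rewrite (_ : Cinf_cst M 1 = 1) ?mul1r//; apply: val_inj.
by apply/asboolP; split=> [a f h|f h];
  rewrite ?(Xl, Yl) ?(XL, YL) ?(XD, YD) ?(XL, YL); ring.
Qed.

Definition bracket X Y : vfield M := MkVfield (bracket_derivation X Y).

(* The values E_i(p) form a basis of T_pM.  As every tangent vector at p is the
   value of a global vector field, T_pM is the set of functionals f |-> X f p. *)
Definition basis_at p (E : 'I_m -> vfield M) : Prop :=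
  forall X, exists! c : 'rV[R]_m, forall f, X f p = \sum_i c 0 i * E i f p.

(* Pointwise trace of a C^oo(M)-linear endomorphism F of the vector fields:
   the trace of its matrix in any basis of T_pM. *)
Definition is_trace_at (F : vfield M -> vfield M) p (t : R) : Prop :=
  exists (E : 'I_m -> vfield M) (A : 'M[R]_m),
    [/\ basis_at p E,
        forall j f, F (E j) f p = \sum_i A i j * E i f p &
        t = \tr A].

Definition trace (F : vfield M -> vfield M) : M -> R :=
  fun p => xget 0 [set t | is_trace_at F p t].

Record riemannian_metric := RiemannianMetric {
  metric :> vfield M -> vfield M -> Cinf M;
  metric_linear : forall Z, scalar (metric^~ Z);
  metric_sym : forall X Y, metric X Y = metric Y X;
  metric_pos : forall X p, (exists f, X f p != 0) -> 0 < metric X X p }.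

Definition levi_civita (g : riemannian_metric)
    (nabla : vfield M -> vfield M -> vfield M) : Prop :=
  [/\ forall Y, linear (nabla^~ Y),
      forall X Y Z, nabla X (Y + Z) = nabla X Y + nabla X Z,
      forall X (f : Cinf M) Y, nabla X (f *: Y) = X f *: Y + f *: nabla X Y,
      forall X Y, nabla X Y - nabla Y X = bracket X Y &
      forall X Y Z, X (g Y Z) = g (nabla X Y) Z + g Y (nabla X Z)].

Definition curvature (nabla : vfield M -> vfield M -> vfield M) X Y Z
    : vfield M :=
  nabla X (nabla Y Z) - nabla Y (nabla X Z) - nabla (bracket X Y) Z.

Definition ricci (nabla : vfield M -> vfield M -> vfield M) Y Z : M -> R :=
  trace (fun X => curvature nabla X Y Z).

Definition lie_derivative V (g : vfield M -> vfield M -> Cinf M) X Y : Cinf M :=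
  V (g X Y) - g (bracket V X) Y - g X (bracket V Y).

Definition einstein (g : riemannian_metric)
    (nabla : vfield M -> vfield M -> vfield M) : Prop :=
  exists a : R, forall Y Z p, ricci nabla Y Z p = a * g Y Z p.

End Calculus.

Arguments riemannian_metric {R m} M.

Record almost_contact_metric (R : realType) (m : nat) (M : manifold R m) :=
  AlmostContactMetric {
    acm_phi : {linear vfield M -> vfield M};
    acm_xi : vfield M;
    acm_eta : {scalar vfield M};
    acm_metric : riemannian_metric M;
    acm_phi2 : forall X, acm_phi (acm_phi X) = - X + acm_eta X *: acm_xi;
    acm_eta_xi : acm_eta acm_xi = 1;
    acm_compat : forall X Y, acm_metric (acm_phi X) (acm_phi Y) =
                             acm_metric X Y - acm_eta X * acm_eta Y }.

Section AlmostContact.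
Context {R : realType} {m : nat} {M : manifold R m}.
Variables (K : almost_contact_metric M)
          (nabla : vfield M -> vfield M -> vfield M).

Local Notation phi := (acm_phi K).
Local Notation xi := (acm_xi K).
Local Notation eta := (acm_eta K).
Local Notation g := (acm_metric K).

Definition kenmotsu : Prop :=
  forall X Y, nabla X (phi Y) - phi (nabla X Y) =
              g (phi X) Y *: xi - eta Y *: phi X.

Definition star_ricci (X Y : vfield M) (p : M) : R :=
  2^-1 * trace (fun Z => curvature nabla X (phi Y) (phi Z)) p.

Definition eta_einstein : Prop :=
  exists alpha beta : Cinf M, forall Y Z p,
    ricci nabla Y Z p = alpha p * g Y Z p + beta p * (eta Y p * eta Z p).

Definition star_ricci_soliton : Prop :=
  exists (V : vfield M) (lambda : R), forall X Y p,
    lie_derivative V g X Y p + 2 * star_ricci X Y p + 2 * lambda * g X Y p = 0.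

End AlmostContact.

(* Main.v *)
(* On an eta-Einstein Kenmotsu manifold of dimension m, S = alpha g + beta eta eta with
   alpha + beta = 1 - m, and the curvature identity [R (X, Y), phi] together with
   Bianchi's first identity gives S^* = - (1 + beta) (g - eta eta).  The 2-form
   rho (X, Y) = trace (phi o R (X, Y)) is then 2 (1 + beta) Phi, and the second Bianchi
   identity yields (d beta + 2 beta eta) /\ Phi = 0, so d beta = - 2 beta eta when m > 3.
   Put u = eta V, G = [xi, V] and H = G + lambda xi.  Taking the Lie derivative of the
   soliton equation along xi gives L_G g, and G is dual to a closed form, so nabla H is
   known: nabla_X H = (lambda - 2 beta) (X - eta X xi) - g (H, X) xi - eta X H.
   The resulting value of R (X, Y) H, traced and compared with S (Y, H) = alpha g (Y, H),
   forces lambda = 0 and beta H = 0; differentiating beta H = 0 gives beta = 0. *)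
Require Import Defs.
From HB Require Import structures.
From mathcomp Require Import all_boot all_order all_algebra.
From mathcomp Require Import all_classical all_reals all_analysis.
From mathcomp Require Import ring lra.

Set Implicit Arguments.
Unset Strict Implicit.
Unset Printing Implicit Defensive.

Import Order.TTheory GRing.Theory Num.Theory.
Import numFieldNormedType.Exports.

Local Open Scope classical_set_scope.
Local Open Scope ring_scope.

(** * Smooth functions of several variables *)

Section PartialDerivatives.
Context {R : realType} {m : nat}.
Implicit Types (f : 'rV[R]_m -> R) (x y z e : 'rV[R]_m).

(** The geometry is algebra over [Cinf M] except where traces enter. Vector fields are abstract
    derivations and [trace] selects a value through an arbitrary basis at a point, so additivity,
    cyclicity and differentiability of traces all need frames and coframes made of globally defined
    objects. The analysis exists to build them: bump functions globalize the coordinate fields, and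
    Hadamard's lemma with smooth coefficients shows that a derivation is determined by its action on
    coordinates. The ring [Cinf M] has zero divisors. This is why frames carry a factor [kappa]
    instead of an inverse, and why no step divides by [beta]: the end of the argument makes
    [beta ^+ 2] vanish pointwise instead of restricting to the set where [beta] is nonzero. The
    obstacle in the geometry is that the soliton equation controls only the symmetric part of
    [nabla V]. The field [[xi, V]] is better behaved: pairing the equation with [xi] expresses its
    dual form through [d u] and [eta], so the skew part of its covariant derivative vanishes, and
    [d u] can afterwards be eliminated in favour of the field itself. *)

Lemma rV_norm_le x (a : R) : 0 <= a -> (forall j, `|x 0 j| <= a) -> `|x| <= a.
Proof.
move=> a0 xa; rewrite /Num.norm/= mx_normrE; apply: bigmax_le => // -[i j] _ /=.
by rewrite ord1.
Qed.

Lemma rV_coord_le x j : `|x 0 j| <= `|x|.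
Proof. by rewrite [leRHS]/Num.norm/= mx_normrE; exact: (le_bigmax _ _ (0, j)). Qed.

Lemma cvg_rV (T : Type) (F : set_system T) {FF : Filter F} (g : T -> 'rV[R]_m) (l : 'rV[R]_m) :
  (forall j, (fun t => g t 0 j) @ F --> l 0 j) -> g @ F --> l.
Proof.
move=> gl; apply/cvgrPdist_le => e e0.
have : \forall t \near F, forall j, `|l 0 j - g t 0 j| <= e.
  by apply: filter_forall => j; move/cvgrPdist_le : (gl j); exact.
apply: filterS => t gt; apply: rV_norm_le => [|j]; first exact: ltW.
by rewrite !mxE.
Qed.

Lemma line_is_derive f x e r : derivable f (r *: e + x) e ->
  is_derive r 1 (fun s => f (s *: e + x)) ('D_e f (r *: e + x)).
Proof.
have E : (fun h : R => h^-1 *: (f ((h *: 1 + r) *: e + x) - f (r *: e + x))) =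
         (fun h : R => h^-1 *: (f (h *: e + (r *: e + x)) - f (r *: e + x))).
  by apply/funext => h; rewrite [h%:A]mulr1 scalerDl addrA.
by move=> df; apply: DeriveDef; rewrite /derivable /derive /= E.
Qed.

Lemma scaled_line_is_derive f x e (t r : R) : derivable f ((r * t) *: e + x) e ->
  is_derive r 1 (fun s : R => f ((s * t) *: e + x))
    (t * 'D_e f ((r * t) *: e + x)).
Proof.
move=> dfr; have h1 := line_is_derive dfr; rewrite mulrC.
apply: (@is_derive1_comp _ (fun s => f (s *: e + x)) (fun s => s * t)) => //.
have : is_derive r (1 : R) ((id : R -> R) * cst t) (r *: 0 + t *: 1).
  exact: is_deriveM.
by rewrite scaler0 add0r [_%:A]mulr1.
Qed.

Lemma mean_value_line f x e (t : R) :
  (forall r : R, 0 <= r <= 1 -> derivable f ((r * t) *: e + x) e) ->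
  exists2 r : R, 0 <= r <= 1 & f (t *: e + x) - f x = t * 'D_e f ((r * t) *: e + x).
Proof.
move=> df; pose g (s : R) := f ((s * t) *: e + x).
have dg (r : R) : 0 <= r <= 1 -> is_derive r 1 g (t * 'D_e f ((r * t) *: e + x)).
  by move=> /df; exact: scaled_line_is_derive.
have cg : {within `[0, 1], continuous g}.
  apply: derivable_within_continuous => r; rewrite in_itv /= => /dg[dgr _].
  exact: dgr.
have [|c] := @MVT_segment R g (fun r => t * 'D_e f ((r * t) *: e + x)) 0 1 ler01 _ cg.
  by move=> r; rewrite in_itv /= => /andP[r0 r1]; apply: dg; rewrite !ltW.
rewrite in_itv /= => c01; rewrite /g mul1r mul0r scale0r add0r subr0 mulr1.
by exists c.
Qed.

(** A staircase from [x] to [y] changes one coordinate at a time. The norm is the sup norm, so all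
    its points stay within [|y - x|] of [x], and the one-variable mean value theorem applies to each
    stair. *)
Lemma mean_value_partial f x y :
  (forall z i, `|z - x| <= `|y - x| -> derivable f z (delta_mx 0 i)) ->
  exists2 z : 'I_m -> 'rV[R]_m, forall i, `|z i - x| <= `|y - x| &
    f y - f x = \sum_i (y 0 i - x 0 i) * 'D_(delta_mx 0 i) f (z i).
Proof.
move=> df.
pose w k : 'rV[R]_m := \row_j (if (j < k)%N then y 0 j else x 0 j).
have wS (i : 'I_m) (r : R) j : ((r *: delta_mx 0 i + w i) : 'rV[R]_m) 0 j =
    if j == i then r + x 0 j else w i 0 j.
  rewrite !mxE /=; case: eqVneq => [->|]; last by rewrite mulr0 add0r.
  by rewrite ltnn mulr1.
have near_w (i : 'I_m) (r : R) : 0 <= r <= 1 ->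
    `|(r * (y 0 i - x 0 i)) *: delta_mx 0 i + w i - x| <= `|y - x|.
  move=> /andP[r0 r1]; apply: rV_norm_le => // j; rewrite mxE wS !mxE.
  have := rV_coord_le (y - x) j; rewrite !mxE.
  case: eqVneq => [->|_].
    rewrite addrK normrM ger0_norm // => h; apply: le_trans h.
    by rewrite ler_piMl.
  by case: ifP => // _ _; rewrite subrr normr0.
have step (i : 'I_m) : exists z, `|z - x| <= `|y - x| /\
    f (w i.+1) - f (w i) = (y 0 i - x 0 i) * 'D_(delta_mx 0 i) f z.
  have [|r r01 E] := @mean_value_line f (w i) (delta_mx 0 i) (y 0 i - x 0 i).
    by move=> r r01; apply: df; exact: near_w.
  exists ((r * (y 0 i - x 0 i)) *: delta_mx 0 i + w i); split; first exact: near_w.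
  rewrite -E; congr (f _ - _); apply/rowP => j; rewrite wS !mxE ltnS leq_eqVlt.
  by rewrite -val_eqE /=; case: eqP => //= /val_inj ->; rewrite subrK.
have [z zP] := choice step; exists z => [i|]; first by case: (zP i).
rewrite -(eq_bigr _ (fun i _ => (zP i).2)).
have := telescope_sumr (fun k => f (w k)) (leq0n m); rewrite big_mkord => ->.
by congr (f _ - f _); apply/rowP => j; rewrite mxE ?ltn_ord.
Qed.


(* Mean values along the coordinate directions replace total differentiability. *)
Lemma is_derive_chain (V : normedModType R) (g : V -> 'rV[R]_m) f (a v : V) :
  (forall i, derivable (fun t => g t 0 i) a v) ->
  (\forall z \near g a, forall i, derivable f z (delta_mx 0 i)) ->
  (forall i, {for g a, continuous ('D_(delta_mx 0 i) f)}) ->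
  is_derive a v (f \o g)
    (\sum_i 'D_v (fun t => g t 0 i) a * 'D_(delta_mx 0 i) f (g a)).
Proof.
move=> dg df cf.
pose w (h : R) := g (h *: v + a).
have cw : w h @[h --> 0] --> g a.
  have : derivable w 0 1.
    apply/derivable_mxP => i j; rewrite ord1.
    exact: (proj1 (derivable1P _ _ _) (dg j)).
  move/derivable1_diffP/differentiable_continuous.
  by rewrite /prop_for /continuous_at /w scale0r add0r.
have [/= e e0 dfe] := (proj1 (nbhs_ballP _ _) df).
have zex h : exists z : 'I_m -> 'rV[R]_m, `|w h - g a| < e ->
    (forall i, `|z i - g a| <= `|w h - g a|) /\
    f (w h) - f (g a) = \sum_i (w h 0 i - g a 0 i) * 'D_(delta_mx 0 i) f (z i).
  have [we|_] := boolP (`|w h - g a| < e); last by exists (fun=> 0).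
  have [z i|z zP E] := @mean_value_partial f (g a) (w h).
    move=> zw; apply: dfe; rewrite -ball_normE /ball_ /= distrC.
    exact: le_lt_trans we.
  by exists z.
have [z zP] := choice zex.
have we : \forall h \near 0, `|w h - g a| < e.
  by move/cvgrPdist_lt : cw => /(_ _ e0); apply: filterS => h; rewrite distrC.
have cz i : z h i @[h --> 0] --> g a.
  apply/cvgrPdist_le => d d0; have /cvgrPdist_le/(_ _ d0) := cw.
  apply: filterS2 we => h /zP[zh _]; rewrite distrC => le_d; rewrite distrC.
  exact: le_trans le_d.
have L : (fun h => h^-1 *: (f (w h) - f (g a))) @ 0^' -->
    \sum_i 'D_v (fun t => g t 0 i) a * 'D_(delta_mx 0 i) f (g a).
  have nE : {near 0^', (fun h => \sum_i (h^-1 *: (w h 0 i - g a 0 i)) *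
      'D_(delta_mx 0 i) f (z h i)) =1 (fun h => h^-1 *: (f (w h) - f (g a)))}.
    apply: cvg_within; apply: filterS we => h /zP[_ ->].
    by rewrite scaler_sumr; apply: eq_bigr => i _; rewrite scalerAl.
  apply: cvg_trans (near_eq_cvg nE) _.
  apply: cvg_big => [|i _]; first exact: add_continuous.
  apply: cvgM; first exact: (dg i).
  have czd : z h i @[h --> 0^'] --> g a.
    by apply: (cvg_comp id _ _ (cz i)); exact: cvg_within.
  exact: (cvg_comp _ _ czd (cf i)).
split; last exact: cvg_lim L.
apply/cvg_ex.
by exists (\sum_i 'D_v (fun t => g t 0 i) a * 'D_(delta_mx 0 i) f (g a)).
Qed.

Lemma continuous_of_bounded_partials f x (B e : R) : 0 < e ->
  (forall z i, `|z - x| < e -> derivable f z (delta_mx 0 i)) ->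
  (forall z i, `|z - x| < e -> `|'D_(delta_mx 0 i) f z| <= B) ->
  {for x, continuous f}.
Proof.
move=> e0 df Bf; have B0 : 0 <= `|B| * m%:R by rewrite mulr_ge0.
have bnd y : `|y - x| < e -> `|f x - f y| <= `|y - x| * (`|B| * m%:R).
  move=> ye; rewrite distrC; have [z i zx|z zx ->] := @mean_value_partial f x y.
    by apply: df; exact: le_lt_trans ye.
  apply: le_trans (ler_norm_sum _ _ _) _.
  have -> : `|y - x| * (`|B| * m%:R) = \sum_(i < m) `|y - x| * `|B|.
    by rewrite sumr_const card_ord mulrA mulr_natr.
  apply: ler_sum => i _.
  rewrite normrM; apply: ler_pM => //; first by have := rV_coord_le (y - x) i; rewrite !mxE.
  by apply: le_trans (ler_norm B); apply: Bf; exact: le_lt_trans ye.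
have near_x d : 0 < d -> \forall y \near x, `|y - x| < d.
  move=> d0; apply/nbhs_ballP; exists d => // y.
  by rewrite -ball_normE /ball_ /= distrC.
(* The added 1 keeps the divisor positive when [B] or [m] is zero. *)
have B1 : 0 < `|B| * m%:R + 1 by rewrite ltr_wpDl.
apply/(@cvgrPdist_le _ _ _ (nbhs x)) => d d0.
apply: filterS2 (near_x _ e0) (near_x _ (divr_gt0 d0 B1)) => y /bnd + yd.
move/le_trans; apply; apply: (@le_trans _ _ (d / (`|B| * m%:R + 1) * (`|B| * m%:R))).
  by apply: ler_wpM2r => //; exact: ltW.
rewrite mulrAC ler_pdivrMr //; apply: ler_wpM2l; first exact: ltW.
by rewrite lerDl.
Qed.

End PartialDerivatives.

(** * Composition of smooth functions *)

Section SmoothComposition.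
Context {R : realType} {m : nat}.
Implicit Types (U V : set 'rV[R]_m) (f h : 'rV[R]_m -> R).

Lemma Ck_on_sub k U V f : V `<=` U -> Ck_on k U f -> Ck_on k V f.
Proof.
move=> VU; elim: k f => [|k IH] f [cf df]; split=> //.
- by move=> x /VU; exact: cf.
- by move=> x /VU; exact: cf.
by move=> i; have [dfi Cfi] := df i; split=> [x /VU|]; [exact: dfi|exact: IH].
Qed.

Lemma smooth_on_continuous U f x : smooth_on U f -> U x -> {for x, continuous f}.
Proof. by move=> /(_ 0%N)[cf _]; exact: cf. Qed.

Lemma smooth_on_derivable U f x i : smooth_on U f -> U x ->
  derivable f x (delta_mx 0 i).
Proof. by move=> /(_ 1%N)[_ /(_ i)[df _]]; exact: df. Qed.

Lemma smooth_on_derive U f i : smooth_on U f -> smooth_on U ('D_(delta_mx 0 i) f).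
Proof. by move=> Sf k; have [_ /(_ i)[]] := Sf k.+1. Qed.

Lemma Ck_on_sum (I : Type) (r : seq I) (F : I -> 'rV[R]_m -> R) k U : open U ->
  (forall i, Ck_on k U (F i)) -> Ck_on k U (fun x => \sum_(i <- r) F i x).
Proof.
move=> oU CF; elim: r => [|i r IH].
  by apply: Ck_on_ext (Ck_on_cst k U 0) => // x _; rewrite big_nil.
by apply: Ck_on_ext (Ck_onD oU (CF i) IH) => // x _; rewrite big_cons.
Qed.

(** Since [f] is smooth to all orders, the induction may replace it by its partial derivatives,
    while [g] loses one order at each step. *)
Lemma Ck_on_comp k U V (g : 'rV[R]_m -> 'rV[R]_m) f : open U -> open V ->
  (forall x, V x -> U (g x)) -> (forall j, Ck_on k V (fun x => g x 0 j)) ->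
  smooth_on U f -> Ck_on k V (f \o g).
Proof.
move=> oU oV gVU; elim: k f => [|k IH] f Cg Sf.
all: have cfg x : V x -> {for x, continuous (f \o g)}.
1,3: move=> Vx; apply: continuous_comp; last exact: smooth_on_continuous (gVU _ Vx).
1,2: by apply: (cvg_rV (F := nbhs x)) => j; have [+ _] := Cg j; apply.
  by split.
have dfg x i : V x -> is_derive x (delta_mx 0 i) (f \o g)
    (\sum_j 'D_(delta_mx 0 i) (fun t => g t 0 j) x * 'D_(delta_mx 0 j) f (g x)).
  move=> Vx; apply: is_derive_chain => [j||j].
  - by have [_ /(_ i)[+ _]] := Cg j; apply.
  - apply: filterS (open_nbhs_nbhs (conj oU (gVU _ Vx))) => z Uz j.
    exact: smooth_on_derivable Sf Uz.
  - apply: smooth_on_continuous (gVU _ Vx); exact: smooth_on_derive.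
split=> // i; split=> [x Vx|]; first by case: (dfg x i Vx).
have E x : V x -> \sum_j 'D_(delta_mx 0 i) (fun t => g t 0 j) x *
    'D_(delta_mx 0 j) f (g x) = 'D_(delta_mx 0 i) (f \o g) x.
  by move=> Vx; have [_ ->] := dfg x i Vx.
apply: (Ck_on_ext oV E); apply: Ck_on_sum => // j; apply: Ck_onM => //.
  by have [_ /(_ i)[]] := Cg j.
apply: (IH ('D_(delta_mx 0 j) f)) => [j'|]; last exact: smooth_on_derive.
exact: Ck_onS.
Qed.

End SmoothComposition.

(** * Hadamard's lemma with smooth coefficients *)

Section Hadamard.
Context {R : realType} {m : nat}.
Implicit Types (f : 'rV[R]_m -> R) (q x z : 'rV[R]_m).
Local Notation mu := (@lebesgue_measure R).

(** Each partial derivative in [x] brings out a factor [t], so the weights [t ^+ k] make this family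
    stable under differentiation. The case [k = 0] gives the coefficients in Hadamard's lemma. *)
Definition radial_mean k f q x : R :=
  \int[mu]_(t in `[0, 1]) (t ^+ k * f (q + t *: (x - q))).

Lemma segment_norm_le q x (t : R) : t \in `[0, 1] ->
  `|q + t *: (x - q) - q| <= `|x - q|.
Proof.
rewrite in_itv /= => /andP[t0 t1].
by rewrite addrAC subrr add0r normrZ ger0_norm // ler_piMl.
Qed.

Lemma continuous_dist q : continuous (fun z : 'rV[R]_m => `|z - q|).
Proof.
move=> z; apply: continuous_comp; last exact: norm_continuous.
by apply: continuousB; [exact: cvg_id | exact: cst_continuous].
Qed.

Lemma open_norm_ball q (r : R) : open [set z | `|z - q| < r].
Proof.
rewrite (_ : [set z | _] = (fun z => `|z - q|) @^-1` [set t | t < r]) //.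
apply: open_comp; last exact: open_lt.
by move=> z _; exact: continuous_dist.
Qed.

Lemma compact_norm_ball q (rho : R) : compact [set z | `|z - q| <= rho].
Proof.
apply: bounded_closed_compact.
  exists (rho + `|q|); split; first exact: num_real.
  move=> M rhoM z Az; apply: ltW; apply: le_lt_trans rhoM.
  by rewrite -(subrK q z) (le_trans (ler_normD _ _)) // lerD2r.
rewrite (_ : [set z | _] = (fun z => `|z - q|) @^-1` [set t | t <= rho]) //.
apply: closed_comp; last exact: closed_le.
by move=> z _; exact: continuous_dist.
Qed.

Lemma closed_ball_bound f q (r rho : R) : rho < r ->
  (forall z, `|z - q| < r -> {for z, continuous f}) ->
  exists B, forall z, `|z - q| <= rho -> `|f z| <= B.
Proof.
move=> rhor cf; pose A : set 'rV[R]_m := [set z | `|z - q| <= rho].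
have [A0|/set0P/negP/negPn/eqP A0] := pselect (A !=set0); last first.
  by exists 0 => z Az; have : A z by []; rewrite A0.
have [c _ cmax] : exists2 c, c \in A & forall t, t \in A -> `|f t| <= `|f c|.
  apply: (EVT_max_rV (f := fun z => `|f z|)) => //; first exact: compact_norm_ball.
  apply: continuous_in_subspaceT => z /set_mem Az.
  apply: continuous_comp; last exact: norm_continuous.
  by apply: cf; exact: le_lt_trans rhor.
by exists `|f c| => z Az; apply: cmax; exact/mem_set.
Qed.

Lemma radial_integrable k f q (r : R) x : `|x - q| < r ->
  (forall z, `|z - q| < r -> {for z, continuous f}) ->
  mu.-integrable `[0, 1] (EFin \o (fun t => t ^+ k * f (q + t *: (x - q)))).
Proof.
move=> xr cf; apply: continuous_compact_integrable; first exact: segment_compact.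
apply: continuous_in_subspaceT => t /set_mem /= t01.
apply: cvgM; first exact: exprn_continuous.
apply: (continuous_comp (f := fun s : R => q + s *: (x - q))).
  apply: cvgD; first exact: cvg_cst.
  by apply: cvgZ; [exact: cvg_id | exact: cvg_cst].
by apply: cf; exact: le_lt_trans (segment_norm_le _ _ _) xr.
Qed.

Lemma Rintegral_unit_cst (B : R) : \int[mu]_(t in `[0, 1]) B = B.
Proof.
by rewrite Rintegral_cst //= lebesgue_measure_itv /= lte_fin ltr01 sube0 mulr1.
Qed.

Lemma integrable_unit_cst (B : R) : mu.-integrable `[0, 1] (EFin \o cst B).
Proof.
apply: continuous_compact_integrable; first exact: segment_compact.
by apply: continuous_subspaceT => t; exact: cst_continuous.
Qed.

Lemma radial_weight_le k (t : R) : t \in `[0, 1] -> 0 <= t ^+ k <= 1.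
Proof.
by rewrite in_itv /= => /andP[t0 t1]; rewrite exprn_ge0 // exprn_ile1.
Qed.

Lemma radial_mean_le k f q (r B : R) x : `|x - q| < r ->
  (forall z, `|z - q| < r -> {for z, continuous f}) ->
  (forall z, `|z - q| <= `|x - q| -> `|f z| <= B) ->
  `|radial_mean k f q x| <= B.
Proof.
move=> xr cf fB; have fi := radial_integrable k xr cf.
apply: le_trans (le_normr_Rintegral _ fi) _ => //.
rewrite -[leRHS]Rintegral_unit_cst.
apply: le_Rintegral => //; first exact: integrable_norm.
  exact: integrable_unit_cst.
move=> t t01; rewrite normrM; have /andP[k0 k1] := radial_weight_le k t01.
rewrite ger0_norm // -[leRHS]mul1r; apply: ler_pM => //.
by apply: fB; exact: segment_norm_le.
Qed.

Lemma delta_norm_le (i : 'I_m) : `|delta_mx 0 i : 'rV[R]_m| <= 1.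
Proof.
by apply: rV_norm_le => // j; rewrite !mxE /= ger0_norm ?ler0n // lern1 leq_b1.
Qed.

Lemma radial_mean_is_derive k f q (r : R) x (i : 'I_m) : `|x - q| < r ->
  (forall z, `|z - q| < r -> {for z, continuous f}) ->
  (forall z, `|z - q| < r -> derivable f z (delta_mx 0 i)) ->
  (forall z, `|z - q| < r -> {for z, continuous ('D_(delta_mx 0 i) f)}) ->
  is_derive x (delta_mx 0 i) (radial_mean k f q)
    (radial_mean k.+1 ('D_(delta_mx 0 i) f) q x).
Proof.
move=> xr cf df cdf; set e := delta_mx 0 i.
(* On the closed ball of the intermediate radius [rho] the derivative is bounded by compactness,
   which supplies the dominating constant; moves of size less than [d] along [e] stay inside that
   ball because [|e| <= 1]. *)
pose rho := (`|x - q| + r) / 2; pose d := rho - `|x - q|.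
have xrho : `|x - q| < rho by rewrite midf_lt.
have rhor : rho < r by rewrite midf_lt.
have [B fB] := closed_ball_bound rhor cdf.
pose F (s t : R) := t ^+ k * f (q + t *: (s *: e + x - q)).
have near_s s : s \in `](- d), d[ -> `|s *: e + x - q| <= rho.
  rewrite in_itv /= -ltr_norml => sd; rewrite -addrA.
  apply: le_trans (ler_normD _ _) _; rewrite -lerBrDr.
  apply: le_trans (ltW sd); rewrite normrZ ler_piMr //; exact: delta_norm_le.
have seg s t : s \in `](- d), d[ -> t \in `[0, 1] ->
    `|q + t *: (s *: e + x - q) - q| <= rho.
  by move=> /near_s sd t01; exact: le_trans (segment_norm_le _ _ t01) sd.
have dF s t : s \in `](- d), d[ -> t \in `[0, 1] -> is_derive s 1 (F ^~ t)
    (t ^+ k.+1 * 'D_e f (q + t *: (s *: e + x - q))).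
  move=> sd t01; have E s' : q + t *: (s' *: e + x - q) =
      (s' * t) *: e + (q + t *: (x - q)).
    by rewrite -addrA scalerDr scalerA mulrC addrCA.
  have := @scaled_line_is_derive _ _ f (q + t *: (x - q)) e t s.
  rewrite -E; under eq_fun do rewrite -E.
  move=> H; have {}H : is_derive s 1 (fun s : R => f (q + t *: (s *: e + x - q)))
      (t * 'D_e f (q + t *: (s *: e + x - q))).
    by apply: H; apply: df; exact: le_lt_trans (seg _ _ sd t01) rhor.
  by have := is_deriveZ (t ^+ k) H; rewrite exprSr -mulrA.
have I0 : 0 \in `](- d), d[.
  by rewrite in_itv /= oppr_lt0 andbb subr_gt0.
have := @cvg_differentiation_under_integral R _ _ mu F `[0, 1]
  (measurable_itv `[0, 1]) 0 (- d) d I0.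
have intF s : s \in `](- d), d[ -> mu.-integrable `[0, 1] (EFin \o F s).
  move=> sd; apply: radial_integrable cf.
  by apply: le_lt_trans rhor; exact: near_s.
move=> /(_ intF).
have derF s t : s \in `](- d), d[ -> t \in `[0, 1] -> derivable (F ^~ t) s 1.
  by move=> sd t01; case: (dF s t sd t01).
move=> /(_ derF (cst `|B|) (fun=> normr_ge0 B) (integrable_unit_cst _)).
have ubF s t : s \in `](- d), d[ -> t \in `[0, 1] ->
    `|partial1of2 F s t| <= cst `|B| t.
  move=> sd t01; rewrite partial1of2E; have [_ ->] := dF s t sd t01.
  rewrite normrM; have /andP[k0 k1] := radial_weight_le k.+1 t01.
  rewrite ger0_norm // -[leRHS]mul1r; apply: ler_pM => //.
  by apply: le_trans (ler_norm B); apply: fB; exact: seg.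
move=> /(_ ubF).
have -> : \int[mu]_(t in `[0, 1]) partial1of2 F 0 t =
    radial_mean k.+1 ('D_e f) q x.
  apply: eq_Rintegral => t /set_mem t01; rewrite partial1of2E.
  by have [_ ->] := dF 0 t I0 t01; rewrite scale0r add0r.
have -> : (fun h : R => h^-1 *: (\int[mu]_(y in `[0, 1]) F (h + 0) y -
    \int[mu]_(y in `[0, 1]) F 0 y)) = (fun h : R => h^-1 *:
    ((radial_mean k f q \o shift x) (h *: e) - radial_mean k f q x)).
  apply/funext => h; rewrite addr0 /F /= scale0r add0r; reflexivity.
move=> L; split; first by apply/cvg_ex; exists (radial_mean k.+1 ('D_e f) q x).
exact: cvg_lim L.
Qed.

(** Continuity is deduced from bounded partial derivatives, which are themselves radial means. The
    induction ranges over all weights because differentiation raises [k]. *)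
Lemma radial_mean_Ck n k f q (r : R) : smooth_on [set z | `|z - q| < r] f ->
  Ck_on n [set z | `|z - q| < r] (radial_mean k f q).
Proof.
set U := [set z | _]; elim: n k f => [|n IH] k f Sf.
all: have cf z : U z -> {for z, continuous f} by exact: smooth_on_continuous.
all: have df z i : U z -> derivable f z (delta_mx 0 i) by exact: smooth_on_derivable.
all: have cdf z i : U z -> {for z, continuous ('D_(delta_mx 0 i) f)}
  by move=> Uz; apply: smooth_on_continuous Uz; exact: smooth_on_derive.
all: have dI x i : U x -> is_derive x (delta_mx 0 i) (radial_mean k f q)
    (radial_mean k.+1 ('D_(delta_mx 0 i) f) q x)
  by move=> Ux; apply: (radial_mean_is_derive _ Ux) => z Uz; [exact: cf|exact: df|exact: cdf].
all: have cI x : U x -> {for x, continuous (radial_mean k f q)}.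
1,3: move=> Ux; pose rho := (`|x - q| + r) / 2.
1,2: have xrho : `|x - q| < rho by rewrite midf_lt.
1,2: have rhor : rho < r by rewrite midf_lt.
1,2: have bnd i : exists B, forall z, `|z - q| <= rho -> `|'D_(delta_mx 0 i) f z| <= B
  by apply: closed_ball_bound rhor _ => z Uz; exact: cdf.
1,2: have [B fB] := choice bnd.
1,2: apply: (@continuous_of_bounded_partials _ _ _ _ (\sum_i `|B i|) (rho - `|x - q|));
  first by rewrite subr_gt0.
1-4: move=> z i zx; have zrho : `|z - q| < rho
  by rewrite -(subrK x z) -addrA (le_lt_trans (ler_normD _ _)) // -ltrBrDr.
1-4: have [dz Dz] := dI z i (lt_trans zrho rhor).
1-4: rewrite ?Dz //.
1,2: apply: (radial_mean_le k.+1 (lt_trans zrho rhor)) => [y Uy|y yz]; first exact: cdf.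
1,2: apply: (@le_trans _ _ `|B i|); last by rewrite (bigD1 i) //= lerDl sumr_ge0.
1,2: by apply: le_trans (ler_norm _); apply: fB; exact: le_trans yz (ltW zrho).
  by split.
split=> // i; split=> [x Ux|]; first by case: (dI x i Ux).
have E x : U x -> radial_mean k.+1 ('D_(delta_mx 0 i) f) q x =
    'D_(delta_mx 0 i) (radial_mean k f q) x.
  by move=> Ux; have [_ ->] := dI x i Ux.
apply: (Ck_on_ext (@open_norm_ball q r) E).
by apply: IH; exact: smooth_on_derive.
Qed.

Lemma Rintegral_unit_sum (I : Type) (s : seq I) (h : I -> R -> R) :
  (forall i, mu.-integrable `[0, 1] (EFin \o h i)) ->
  \int[mu]_(t in `[0, 1]) (\sum_(i <- s) h i t) =
  \sum_(i <- s) \int[mu]_(t in `[0, 1]) h i t.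
Proof.
move=> ih.
have ihs s' : mu.-integrable `[0, 1] (EFin \o (fun t => \sum_(i <- s') h i t)).
  have -> : EFin \o (fun t => \sum_(i <- s') h i t) =
      (fun t => \sum_(i <- s') (EFin \o h i) t)%E.
    by apply/funext => t /=; rewrite sumEFin.
  by apply: integrable_sum => //.
elim: s => [|i s IH].
  by rewrite big_nil; under eq_Rintegral do rewrite big_nil; rewrite Rintegral_unit_cst.
rewrite big_cons -IH -RintegralD //.
by apply: eq_Rintegral => t _; rewrite big_cons.
Qed.

(** The fundamental theorem of calculus along the segment [c] from [q] to [x], with the factors
    [x 0 i - q 0 i] pulled out of the integral. *)
Lemma hadamard f q (r : R) x : smooth_on [set z | `|z - q| < r] f ->
  `|x - q| < r ->
  f x - f q = \sum_i (x 0 i - q 0 i) * radial_mean 0 ('D_(delta_mx 0 i) f) q x.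
Proof.
move=> Sf xr; pose c (t : R) := q + t *: (x - q).
have cU t : t \in `[0, 1] -> `|c t - q| < r.
  by move=> t01; exact: le_lt_trans (segment_norm_le _ _ t01) xr.
have df z i : `|z - q| < r -> derivable f z (delta_mx 0 i).
  by move=> zr; exact: smooth_on_derivable Sf zr.
have cdf z i : `|z - q| < r -> {for z, continuous ('D_(delta_mx 0 i) f)}.
  move=> zr; apply: (smooth_on_continuous (U := [set z | `|z - q| < r])) => //.
  exact: smooth_on_derive.
have dc (t : R) (i : 'I_m) : is_derive t 1 (fun t => c t 0 i) (x 0 i - q 0 i).
  have -> : (fun t => c t 0 i) = cst (q 0 i : R) + ((id : R -> R) * cst (x 0 i - q 0 i : R)).
    by apply/funext => s; rewrite !mxE.
  have : is_derive t (1 : R) (cst (q 0 i : R) + ((id : R -> R) * cst (x 0 i - q 0 i : R)))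
      (0 + (t *: 0 + (x 0 i - q 0 i) *: 1)).
    by apply: is_deriveD; exact: is_deriveM.
  by rewrite scaler0 !add0r [_%:A]mulr1.
pose dg (t : R) := \sum_i (x 0 i - q 0 i) * 'D_(delta_mx 0 i) f (c t).
have Dg (t : R) : t \in `[0, 1] -> is_derive t 1 (f \o c) (dg t).
  move=> /cU ctr.
  have -> : dg t = \sum_i 'D_1 (fun t => c t 0 i) t * 'D_(delta_mx 0 i) f (c t).
    by apply: eq_bigr => i _; have [_ ->] := dc t i.
  apply: is_derive_chain => [i||i]; last exact: cdf.
  - by case: (dc t i).
  apply: filterS (open_nbhs_nbhs (conj (@open_norm_ball q r) ctr)) => z zr i.
  exact: df.
have cdg : {within `[0, 1], continuous dg}.
  apply: continuous_in_subspaceT => t /set_mem /= t01.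
  apply: cvg_big => [|i _]; first exact: add_continuous.
  apply: cvgM; first exact: cvg_cst.
  have cc : c @ t --> c t.
    apply: cvgD; first exact: cvg_cst.
    by apply: cvgZ; [exact: cvg_id | exact: cvg_cst].
  exact: (cvg_comp _ _ cc (cdf _ i (cU _ t01))).
have cfc (t : R) : t \in `[0, 1] -> {for t, continuous (f \o c)}.
  move=> /Dg[+ _].
  by move/derivable1_diffP/differentiable_continuous.
have I01 : 0 \in `[0 : R, 1] /\ 1 \in `[0 : R, 1] by split; rewrite in_itv /= lexx ler01.
have dcc : derivable_oo_LRcontinuous (f \o c) 0 1.
  split.
  - move=> t; rewrite in_itv /= => /andP[t0 t1].
    have /Dg[//] : t \in `[0, 1] by rewrite in_itv /= !ltW.
  - by apply: cvg_at_right_filter; exact: cfc I01.1.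
  - by apply: cvg_at_left_filter; exact: cfc I01.2.
have dE : {in `]0, 1[, (f \o c)^`()%classic =1 dg}.
  move=> t; rewrite in_itv /= => /andP[t0 t1]; rewrite derive1E.
  by have [|_ ->] := Dg t; first by rewrite in_itv /= !ltW.
have := continuous_FTC2 ltr01 cdg dcc dE.
move/(congr1 fine); rewrite -/(Rintegral _ _ _) /= /c scale1r scale0r addr0.
rewrite addrCA subrr addr0 => <-.
have hi i : mu.-integrable `[0, 1] (EFin \o (fun t => 'D_(delta_mx 0 i) f (c t))).
  rewrite (_ : (fun t => _) = (fun t => t ^+ 0 * 'D_(delta_mx 0 i) f (c t))).
    exact: (@radial_integrable 0 _ q r x xr (fun z => @cdf z i)).
  by apply/funext => t; rewrite expr0 mul1r.
rewrite Rintegral_unit_sum => [|i].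
  apply: eq_bigr => i _; rewrite RintegralZl //.
  by congr (_ * _); apply: eq_Rintegral => t _; rewrite expr0 mul1r.
rewrite (_ : EFin \o _ = fun t => (x 0 i - q 0 i)%R%:E *
    (EFin \o (fun t => 'D_(delta_mx 0 i)%R f (c t))) t)%E.
  exact: integrableZl.
by apply/funext => t /=; rewrite EFinM.
Qed.

Lemma radial_mean_center f q : radial_mean 0 f q q = f q.
Proof.
rewrite /radial_mean; under eq_Rintegral do rewrite expr0 mul1r subrr scaler0 addr0.
exact: Rintegral_unit_cst.
Qed.

End Hadamard.

(** * Flat functions and bump functions *)

Section FlatFunction.
Context {R : realType}.
Implicit Types (t : R) (k : nat).

(** The powers of [t^-1] make the family stable under differentiation; only [flat 0] enters the bump
    functions. *)
Definition flat k t : R := if 0 < t then t^-1 ^+ k * expR (- t^-1) else 0.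

Lemma flat_le0 k t : t <= 0 -> flat k t = 0.
Proof. by rewrite /flat ltNge => ->. Qed.

Lemma flat_gt0 k t : 0 < t -> 0 < flat k t.
Proof. by move=> t0; rewrite /flat t0 mulr_gt0 ?expR_gt0 // exprn_gt0 // invr_gt0. Qed.

(* [expR y = expR (y / N) ^+ N >= (y / N) ^+ N] at [y = t^-1], [N = k + 2]. *)
Lemma flat_le_sqr k t : `|flat k t| <= k.+2%:R ^+ k.+2 * t ^+ 2.
Proof.
have [t0|t0] := leP t 0.
  by rewrite flat_le0 // normr0 mulr_ge0 ?sqr_ge0 // exprn_ge0.
rewrite gtr0_norm ?flat_gt0 // /flat t0 expRN.
set N := k.+2; have N0 : 0 < N%:R :> R by rewrite ltr0n.
have y0 : 0 < t^-1 / N%:R by rewrite divr_gt0 // invr_gt0.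
have le_exp : (t^-1 / N%:R) ^+ N <= expR t^-1.
  have -> : expR t^-1 = expR (t^-1 / N%:R) ^+ N.
    by rewrite -expRM_natl mulrC divfK // gt_eqF.
  apply: lerXn2r; rewrite ?nnegrE ?expR_ge0 ?(ltW y0) //.
  by apply: le_trans (expR_ge1Dx _); rewrite lerDr.
apply: (@le_trans _ _ (t^-1 ^+ k * ((t^-1 / N%:R) ^+ N)^-1)).
  rewrite ler_wpM2l ?exprn_ge0 ?invr_ge0 ?(ltW t0) //.
  by rewrite lef_pV2 // posrE ?expR_gt0 // exprn_gt0.
rewrite -exprVn invf_div invrK exprMn mulrCA ler_wpM2l ?exprn_ge0 //.
by rewrite /N -addn2 exprD mulrA -exprMn mulVf ?gt_eqF // expr1n mul1r.
Qed.

Lemma flat_is_derive k t :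
  is_derive t 1 (flat k) (flat k.+2 t - k%:R * flat k.+1 t).
Proof.
have [t0|t0|t0] := ltrgtP t 0.
- rewrite !flat_le0 ?(ltW t0) // mulr0 subr0.
  apply: (near_eq_is_derive (f := (cst 0 : R -> R))).
  near=> s; rewrite flat_le0 //; apply: ltW; near: s; exact: lt_nbhsl.
- pose p y : R := y ^+ k * expR (- y).
  apply: (near_eq_is_derive (f := p \o GRing.inv)).
    by near=> s; rewrite /flat (_ : 0 < s) //; near: s; exact: lt_nbhsr.
  have dinv : is_derive t 1 GRing.inv (- t^-1 ^+ 2).
    split; first by apply: (derivableV (f := id)); rewrite ?gt_eqF.
    by rewrite (deriveV (f := id)) ?gt_eqF // derive_id exprVn [_ *: _]mulr1.
  have dp : is_derive t^-1 1 p (k%:R * t^-1 ^+ k.-1 * expR (- t^-1) -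
      t^-1 ^+ k * expR (- t^-1)).
    have dX : is_derive t^-1 (1 : R) ((id : R -> R) ^+ k) ((k%:R * t^-1 ^+ k.-1) *: 1).
      exact: is_deriveX.
    have dN : is_derive t^-1 (1 : R) (expR \o -%R) (expR (- t^-1) * -1).
      exact: is_derive1_comp.
    have := is_deriveM dX dN.
    rewrite (_ : id ^+ k * (expR \o -%R) = p); last first.
      by apply/funext => y; rewrite /p !fctE.
    move=> H; apply: (is_derive_eq H).
    rewrite !fctE [_ *: 1]mulr1; set E := expR _; rewrite -![_ *: _]/(_ * _) /=; ring.
  have := is_derive1_comp dp dinv.
  move=> H; apply: (is_derive_eq H); rewrite /flat t0.
  by case: (k) => [|j] /=; rewrite ?exprS; ring.
rewrite t0 !flat_le0 // mulr0 subr0.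
(* At 0 the quadratic bound of [flat_le_sqr] leaves a difference quotient of size at most
   [C * |h|]. *)
have L : (fun h => h^-1 *: (flat k (h *: 1 + 0) - flat k 0)) @ 0^' --> 0.
  apply/cvgrPdist_le => e e0.
  set C : R := k.+2%:R ^+ k.+2; have C0 : 0 < C by rewrite exprn_gt0.
  apply: cvg_within; near=> h.
  rewrite addr0 [_%:A]mulr1 (flat_le0 _ (lexx 0)) subr0 sub0r normrN normrM normfV.
  have [->|h0] := eqVneq h 0; first by rewrite normr0 invr0 mul0r ltW.
  have hp : 0 < `|h| by rewrite normr_gt0.
  rewrite ler_pdivrMl //; apply: le_trans (flat_le_sqr k h) _.
  rewrite -/C -(ger0_norm (sqr_ge0 h)) normrX expr2 mulrCA ler_pM2l //.
  rewrite mulrC -ler_pdivlMr //; apply: ltW; near: h.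
  apply: (@pseudometric_normed_Zmodule.nbhs0_lt _ R^o); exact: divr_gt0.
split; first by apply/cvg_ex; exists 0.
exact: cvg_lim L.
Unshelve. all: by end_near. Qed.

End FlatFunction.

Section Bump.
Context {R : realType} {m : nat}.
Implicit Types (U : set 'rV[R]_m) (f : 'rV[R]_m -> R) (q x : 'rV[R]_m).

Lemma is_derive_lineP f x e (d : R) :
  is_derive (0 : R) (1 : R) (fun h : R => f (h *: e + x)) d -> is_derive x e f d.
Proof.
move=> [df dE]; split; first exact: (proj2 (derivable1P f x e) df).
rewrite -dE /derive; set g1 := fun h => h^-1 *: _; set g2 := fun h => h^-1 *: _.
suff -> : g1 = g2 by [].
by apply/funext => h; rewrite /g1 /g2 /= addr0 scale0r add0r [_%:A]mulr1.
Qed.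

Lemma is_derive_comp1 (p : R -> R) f x e (d : R) : derivable f x e ->
  is_derive (f x) 1 p d -> is_derive x e (p \o f) (d * 'D_e f x).
Proof.
move=> df dp; apply: is_derive_lineP.
apply: (@is_derive1_comp _ p (fun h : R => f (h *: e + x))).
  by rewrite scale0r add0r.
have := @line_is_derive _ _ f x e 0; rewrite scale0r add0r; exact.
Qed.

Lemma Ck_on_flat n k U f : open U -> smooth_on U f -> Ck_on n U (flat k \o f).
Proof.
move=> oU Sf; elim: n k => [|n IH] k.
all: have cf x : U x -> {for x, continuous (flat k \o f)}.
1,3: move=> Ux; apply: continuous_comp; first exact: smooth_on_continuous Sf Ux.
1,2: apply: differentiable_continuous; apply/derivable1_diffP.
1,2: by case: (flat_is_derive k (f x)).
  by split.
split=> // i.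
have dff x : U x -> is_derive x (delta_mx 0 i) (flat k \o f)
    ((flat k.+2 (f x) - k%:R * flat k.+1 (f x)) * 'D_(delta_mx 0 i) f x).
  move=> Ux; apply: is_derive_comp1; last exact: flat_is_derive.
  exact: smooth_on_derivable Sf Ux.
split=> [x Ux|]; first by case: (dff x Ux).
have E x : U x -> (((flat k.+2 \o f) - cst k%:R * (flat k.+1 \o f)) *
    'D_(delta_mx 0 i) f) x = 'D_(delta_mx 0 i) (flat k \o f) x.
  by move=> Ux; have [_ ->] := dff x Ux.
apply: (Ck_on_ext oU E); apply: Ck_onM => //.
  apply: Ck_onB => //; apply: Ck_onM => //; exact: Ck_on_cst.
exact: smooth_on_derive.
Qed.

Lemma is_derive_coord (i j : 'I_m) x :
  is_derive x (delta_mx 0 i) (fun z : 'rV[R]_m => z 0 j) ((j == i)%:R : R).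
Proof.
apply: is_derive_lineP.
have -> : (fun h : R => (h *: delta_mx 0 i + x : 'rV[R]_m) 0 j) =
    (id : R -> R) * cst ((j == i)%:R : R) + cst (x 0 j : R).
  by apply/funext => h; rewrite !mxE.
have : is_derive (0 : R) (1 : R) ((id : R -> R) * cst ((j == i)%:R : R) + cst (x 0 j : R))
    ((0 : R) *: 0 + (j == i)%:R *: 1 + 0).
  by apply: is_deriveD; exact: is_deriveM.
by rewrite scaler0 add0r addr0 [_ *: 1]mulr1.
Qed.

Lemma Ck_on_coord n U j : open U -> Ck_on n U (fun z : 'rV[R]_m => z 0 j).
Proof.
move=> oU; case: n => [|n].
all: have cc x : U x -> {for x, continuous (fun z : 'rV[R]_m => z 0 j)}
  by move=> _; exact: coord_continuous.
  by split.
split=> // i; split=> [x _|]; first by case: (is_derive_coord i j x).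
have E x : U x -> cst ((j == i)%:R : R) x = 'D_(delta_mx 0 i) (fun z : 'rV[R]_m => z 0 j) x.
  by move=> _; have [_ ->] := is_derive_coord i j x.
by apply: (Ck_on_ext oU E); exact: Ck_on_cst.
Qed.

Definition bump q (r : R) x : R :=
  \prod_(j < m) flat 0 (r ^+ 2 - (x 0 j - q 0 j) ^+ 2).

Lemma bump_center q r : 0 < r -> bump q r q != 0.
Proof.
move=> r0; apply/prodf_neq0 => j _.
by rewrite subrr expr0n subr0 gt_eqF // flat_gt0 // exprn_gt0.
Qed.

Lemma bump_support q r x : 0 < r -> bump q r x != 0 -> `|x - q| <= r.
Proof.
move=> r0 /prodf_neq0 xq; apply: rV_norm_le => [|j]; first exact: ltW.
have := xq j isT; rewrite !mxE.
have [le0|+ _] := leP (r ^+ 2 - (x 0 j - q 0 j) ^+ 2) 0; first by rewrite flat_le0 // eqxx.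
rewrite subr_gt0 => lt; rewrite -[leRHS](gtr0_norm r0).
by rewrite -ler_sqr ?nnegrE // -!normrX !ger0_norm ?sqr_ge0 // ltW.
Qed.

Lemma bump_smooth q r U : open U -> smooth_on U (bump q r).
Proof.
move=> oU n; rewrite /bump; elim: (index_enum _) => [|j s IH].
  by apply: Ck_on_ext (Ck_on_cst n U 1) => // x _; rewrite big_nil.
apply: Ck_on_ext (Ck_onM oU _ IH) => [//|x _|]; first by rewrite big_cons.
apply: (Ck_on_flat n 0 (f := fun x : 'rV[R]_m => r ^+ 2 - (x 0 j - q 0 j) ^+ 2)) => // n'.
apply: Ck_onB => //; first exact: Ck_on_cst.
have Cx : Ck_on n' U ((fun x : 'rV[R]_m => x 0 j) - cst (q 0 j)).
  by apply: Ck_onB => //; [exact: Ck_on_coord | exact: Ck_on_cst].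
by apply: Ck_on_ext (Ck_onM oU Cx Cx) => // x _; rewrite /= expr2.
Qed.

End Bump.

(** * Vector fields and local frames on a manifold *)

Section ChartExtension.
Context {R : realType} {m : nat} (M : manifold R m).
Implicit Types (c d : chart R m M) (h : 'rV[R]_m -> R) (x : 'rV[R]_m) (p : M).

Local Notation img c := (chart_map c @` chart_dom c).

Lemma Ck_on_local k (U : set 'rV[R]_m) h :
  (forall x, U x -> exists2 V, open V & V x /\ Ck_on k V h) -> Ck_on k U h.
Proof.
elim: k h => [|k IH] h loc.
all: have ch x : U x -> {for x, continuous h}
  by move=> /loc[V _ [Vx [cV _]]]; exact: cV.
  by split.
split=> // i; split=> [x /loc[V _ [Vx [_ /(_ i)[dV _]]]]|]; first exact: dV.
apply: IH => x /loc[V oV [Vx [_ /(_ i)[_ CV]]]]; by exists V.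
Qed.

Lemma chart_invP c x : img c x ->
  chart_dom c (chart_inv c x) /\ chart_map c (chart_inv c x) = x.
Proof. by move=> [p cp <-]; rewrite chart_mapK. Qed.

Lemma chart_img c p : chart_dom c p -> img c (chart_map c p).
Proof. by move=> cp; exists p. Qed.

Lemma chart_inv_continuous_at c x : img c x -> {for x, continuous (chart_inv c)}.
Proof.
move=> cx; have := @chart_inv_continuous _ _ _ c.
by rewrite continuous_open_subspace; [apply; exact/mem_set|exact: chart_img_open].
Qed.

Lemma open_chart_preimage c (A : set M) : open A ->
  open (img c `&` chart_inv c @^-1` A).
Proof.
move=> oA; rewrite openE => x [cx Ax]; apply: filterI.
  by apply: open_nbhs_nbhs; split=> //; exact: chart_img_open.
by apply: chart_inv_continuous_at => //; exact: open_nbhs_nbhs.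
Qed.

Definition chart_extend c h : M -> R :=
  fun p => if `[< chart_dom c p >] then h (chart_map c p) else 0.

Lemma chart_extend_in c h p : chart_dom c p -> chart_extend c h p = h (chart_map c p).
Proof. by rewrite /chart_extend => /asboolP ->. Qed.

Lemma chart_extend_out c h p : ~ chart_dom c p -> chart_extend c h p = 0.
Proof. by rewrite /chart_extend => /asboolPn/negbTE ->. Qed.

Lemma chart_map_continuous_at c p : chart_dom c p -> {for p, continuous (chart_map c)}.
Proof.
move=> cp; have := @chart_map_continuous _ _ _ c.
by rewrite continuous_open_subspace; [apply; exact/mem_set|exact: chart_dom_open].
Qed.

Lemma open_chart_image c (A : set 'rV[R]_m) : open A ->
  open (chart_dom c `&` chart_map c @^-1` A).
Proof.
move=> oA; rewrite openE => p [cp Ap]; apply: filterI.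
  by apply: open_nbhs_nbhs; split=> //; exact: chart_dom_open.
by apply: chart_map_continuous_at => //; exact: open_nbhs_nbhs.
Qed.

(** The image [L] of the compact set [K] is closed because [M] is Hausdorff. Hence [M] is covered by
    two open sets: the part of the chart lying over [U], where the transition maps give smoothness,
    and the complement of [L], where the extension is zero. *)
Lemma chart_extend_smooth c h (K U : set 'rV[R]_m) : atlas c ->
  open U -> U `<=` img c -> compact K -> K `<=` U -> smooth_on U h ->
  (forall x, img c x -> h x != 0 -> K x) -> chart_extend c h \in @smooth R m M.
Proof.
move=> ac oU Uc cK KU Sh hK; pose L := chart_inv c @` K.
have clL : closed L.
  apply: compact_closed; first exact: manifold_hausdorff.
  apply: continuous_compact cK; apply: (@continuous_subspaceW _ _ _ (img c)).
    exact: subset_trans KU Uc.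
  exact: chart_inv_continuous.
apply/asboolP => d ad k; apply: Ck_on_local => x dx.
have [dp xp] := chart_invP dx.
have oUc := open_chart_image c oU.
have [cp|cp] := pselect ((chart_dom c `&` chart_map c @^-1` U) (chart_inv d x)).
  exists (img d `&` chart_inv d @^-1` (chart_dom c `&` chart_map c @^-1` U)).
    exact: open_chart_preimage.
  split=> //; set V := _ `&` _.
  have oV : open V by exact: open_chart_preimage.
  have VE : V `<=` chart_map d @` (chart_dom d `&` chart_dom c).
    by move=> y [/chart_invP[dy yE] [cy _]]; exists (chart_inv d y).
  apply: (Ck_on_ext oV (f := h \o (fun y => chart_map c (chart_inv d y)))).
    by move=> y [_ [cy _]]; rewrite /= chart_extend_in.
  apply: (Ck_on_comp oU oV) => [y [_ [_ Uy]] //|j|//].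
  by apply: Ck_on_sub VE _; exact: atlas_compatible.
exists (img d `&` chart_inv d @^-1` (~` L)).
  by apply: open_chart_preimage; exact: closed_openC.
set V := _ `&` _; have oV : open V.
  by apply: open_chart_preimage; exact: closed_openC.
split.
  split=> // -[y Ky yx]; apply: cp; rewrite -yx.
  have [cy yE] := chart_invP (Uc _ (KU _ Ky)).
  by split=> //; rewrite /= yE; exact: KU.
apply: (Ck_on_ext oV (f := cst 0)); last exact: Ck_on_cst.
move=> y [_ Ly] /=; have [cy|cy] := pselect (chart_dom c (chart_inv d y)); last first.
  by rewrite chart_extend_out.
rewrite chart_extend_in //; apply/esym/eqP/negPn/negP => hy0.
apply: Ly; exists (chart_map c (chart_inv d y)); last by rewrite chart_mapK.
exact: hK (chart_img cy) hy0.
Qed.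

Lemma chart_closed_ball c p : chart_dom c p ->
  exists2 s : R, 0 < s & [set z | `|z - chart_map c p| < s] `<=` img c.
Proof.
move=> cp; have : nbhs (chart_map c p) (img c).
  by apply: open_nbhs_nbhs; split; [exact: chart_img_open|exact: chart_img].
move=> /nbhs_ballP[s s0 sb]; exists s => // z zs; apply: sb.
by rewrite -ball_normE /ball_ /= distrC.
Qed.

End ChartExtension.

(** * Vector fields as derivations *)

Section VectorFields.
Context {R : realType} {m : nat} {M : manifold R m}.
Implicit Types (X Y : vfield M) (f h : Cinf M) (p : M).

Lemma CinfP f h : (forall p, f p = h p) -> f = h.
Proof. by move=> fh; apply/val_inj/funext. Qed.

Lemma CinfDE f h p : (f + h) p = f p + h p. Proof. by []. Qed.
Lemma CinfNE f p : (- f) p = - f p. Proof. by []. Qed.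
Lemma CinfME f h p : (f * h) p = f p * h p. Proof. by []. Qed.
Lemma Cinf0E p : (0 : Cinf M) p = 0. Proof. by []. Qed.
Lemma Cinf1E p : (1 : Cinf M) p = 1. Proof. by []. Qed.
Lemma Cinf_cstE (a : R) p : Cinf_cst M a p = a. Proof. by []. Qed.
Lemma CinfXE f n p : (f ^+ n) p = f p ^+ n.
Proof. by elim: n => // n IH; rewrite !exprS CinfME IH. Qed.
Lemma Cinf_sumE (I : Type) (r : seq I) (P : pred I) (F : I -> Cinf M) p :
  (\sum_(i <- r | P i) F i) p = \sum_(i <- r | P i) F i p.
Proof. exact: (big_morph (fun f : Cinf M => f p) (fun f h => CinfDE f h p) (Cinf0E p)). Qed.

Lemma vfieldP X Y : (forall f p, X f p = Y f p) -> X = Y.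
Proof. by move=> XY; apply/val_inj/funext => f; apply: CinfP => p; exact: XY. Qed.

Lemma vfield_eq X Y : (forall f, X f = Y f) -> X = Y.
Proof. by move=> XY; apply: vfieldP => f p; rewrite XY. Qed.

Lemma vfDE X Y f : (X + Y) f = X f + Y f. Proof. by []. Qed.
Lemma vfNE X f : (- X) f = - X f. Proof. by []. Qed.
Lemma vf0E f : (0 : vfield M) f = 0. Proof. by []. Qed.
Lemma vfZE (a : Cinf M) X f : (a *: X) f = a * X f. Proof. by []. Qed.
Lemma vf_sumE (I : Type) (r : seq I) (P : pred I) (F : I -> vfield M) f :
  (\sum_(i <- r | P i) F i) f = \sum_(i <- r | P i) F i f.
Proof. exact: (big_morph (fun X : vfield M => X f) (fun X Y => vfDE X Y f) (vf0E f)). Qed.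

Lemma vfM X f h : X (f * h) = X f * h + f * X h.
Proof. by have /asboolP[_] := vfield_derivation X; exact. Qed.

Lemma vf_lin X (a : R) f h : X (Cinf_cst M a * f + h) = Cinf_cst M a * X f + X h.
Proof. by have /asboolP[+ _] := vfield_derivation X; exact. Qed.

Lemma vfD X f h : X (f + h) = X f + X h.
Proof.
have E : Cinf_cst M 1 = 1 by apply: CinfP.
by have := vf_lin X 1 f h; rewrite E !mul1r.
Qed.

Lemma vf0 X : X 0 = 0.
Proof. by apply: (addrI (X 0)); rewrite -vfD !addr0. Qed.

Lemma vfC X (a : R) : X (Cinf_cst M a) = 0.
Proof.
have X1 : X 1 = 0.
  by have := vfM X 1 1; rewrite !mulr1 mul1r => /esym/eqP; rewrite -subr_eq0 addrK => /eqP.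
by have := vf_lin X a 1 0; rewrite mulr1 addr0 X1 vf0 mulr0 addr0.
Qed.

Lemma vfN X f : X (- f) = - X f.
Proof. by apply/eqP; rewrite -addr_eq0 -vfD addNr vf0. Qed.

Lemma vf_sum X (I : Type) (r : seq I) (P : pred I) (F : I -> Cinf M) :
  X (\sum_(i <- r | P i) F i) = \sum_(i <- r | P i) X (F i).
Proof. exact: (big_morph X (vfD X) (vf0 X)). Qed.

Definition CinfE := (CinfDE, CinfNE, CinfME).
Lemma bracket_fun X Y f : bracket X Y f = X (Y f) - Y (X f). Proof. by []. Qed.

End VectorFields.

(** Applied to an arbitrary function, an identity between vector fields becomes a polynomial
    identity in [Cinf M] whose atoms are iterated derivatives; this settles the curvature
    computations. *)
Ltac vf_simp := repeat progress
  (do 3 rewrite ?bracket_fun ?vfDE ?vfNE ?vfZE ?vf0E; rewrite ?vfD ?vfN ?vfM).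
Ltac vfield_ring := apply: vfield_eq => ?; vf_simp; ring.

(** * Coordinate expressions of vector fields and local frames *)

Section LocalFrames.
Context {R : realType} {m : nat} {M : manifold R m}.
Implicit Types (c : chart R m M) (X Y : vfield M) (f h : Cinf M) (p : M).
Implicit Types (x : 'rV[R]_m).

Local Notation img c := (chart_map c @` chart_dom c).
Local Notation nball x s := [set z | `|z - x| < s].

Lemma Cinf_smooth_on c f : atlas c -> smooth_on (img c) (f \o chart_inv c).
Proof. by move=> ac; have /asboolP := Cinf_smooth f; exact. Qed.

Lemma smooth_on_sub (U V : set 'rV[R]_m) (F : 'rV[R]_m -> R) : V `<=` U ->
  smooth_on U F -> smooth_on V F.
Proof. by move=> VU SF k; exact: Ck_on_sub VU _. Qed.

(** A function on a coordinate ball becomes global at the price of a bump factor, which does not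
    vanish at the centre. The radius [s / 2] keeps the support compact inside the ball. *)
Lemma cut_exists c x (s : R) (F : 'rV[R]_m -> R) : atlas c -> 0 < s ->
  nball x s `<=` img c -> smooth_on (nball x s) F ->
  exists f : Cinf M,
    (forall p, chart_dom c p -> f p = bump x (s / 2) (chart_map c p) * F (chart_map c p)) /\
    (forall p, ~ chart_dom c p -> f p = 0).
Proof.
move=> ac s0 sc SF; pose U : set 'rV[R]_m := nball x s.
pose K : set 'rV[R]_m := [set z | `|z - x| <= s / 2].
have s20 : 0 < s / 2 by rewrite divr_gt0.
have KU : K `<=` U.
  by move=> z /= zK; apply: le_lt_trans zK _; rewrite ltr_pdivrMr // ltr_pMr // ltr1n.
have Sm : chart_extend c (bump x (s / 2) * F) \in @smooth R m M.
  apply: (chart_extend_smooth (K := K) (U := U)) => //.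
  - exact: open_norm_ball.
  - exact: compact_norm_ball.
  - move=> k; apply: Ck_onM; [exact: open_norm_ball|apply: bump_smooth|exact: SF].
    exact: open_norm_ball.
  - by move=> z _; rewrite fctE mulf_eq0 negb_or => /andP[/(bump_support s20)].
exists (MkCinf Sm); split=> p cp /=; first by rewrite chart_extend_in.
by rewrite chart_extend_out.
Qed.

(* Multiplying Hadamard's expansion of [f] by the square of a bump function
   turns it into an identity between global functions. *)
Lemma vfield_chart c (chi : Cinf M) (a : 'I_m -> Cinf M) X f p :
  atlas c -> chart_dom c p ->
  (forall j p, chart_dom c p -> a j p = chi p * chart_map c p 0 j) ->
  (chi ^+ 2 * X f) p = \sum_i (chi * X (a i) - a i * X chi) p *
    'D_(delta_mx 0 i) (f \o chart_inv c) (chart_map c p).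
Proof.
move=> ac cp aE; set x := chart_map c p; set F := f \o chart_inv c.
have [s s0 sc] := chart_closed_ball cp.
have SF : smooth_on (nball x s) F.
  exact: smooth_on_sub sc (Cinf_smooth_on f ac).
have oB : open (nball x s) by exact: open_norm_ball.
have [Psi [Psi1 Psi0]] := cut_exists ac s0 sc (fun k => Ck_on_cst k (nball x s) 1).
have Sb i : smooth_on (nball x s) ((fun z : 'rV[R]_m => z 0 i) - cst (x 0 i)).
  by move=> k; apply: Ck_onB => //; [exact: Ck_on_coord|exact: Ck_on_cst].
have [b bE] := choice (fun i => cut_exists ac s0 sc (Sb i)).
have SH i : smooth_on (nball x s) (radial_mean 0 ('D_(delta_mx 0 i) F) x).
  by move=> k; apply: radial_mean_Ck; exact: smooth_on_derive.
have [H HE] := choice (fun i => cut_exists ac s0 sc (SH i)).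
have s20 : 0 < s / 2 by rewrite divr_gt0.
have Psip : Psi p != 0 by rewrite Psi1 // mulr1 bump_center.
have bp i : b i p = 0 by rewrite (bE i).1 // !fctE subrr mulr0.
have Hp i : H i p = Psi p * 'D_(delta_mx 0 i) F x.
  by rewrite (HE i).1 // Psi1 // mulr1 radial_mean_center.
have E1 : Psi * Psi * (f - Cinf_cst M (f p)) = \sum_i b i * H i.
  apply: CinfP => y; rewrite Cinf_sumE.
  have [cy|cy] := pselect (chart_dom c y); last first.
    rewrite !CinfME Psi0 // !mul0r big1 // => i _.
    by rewrite CinfME (bE i).2 // mul0r.
  rewrite !CinfME CinfDE CinfNE Psi1 // mulr1.
  have [B0|B0] := eqVneq (bump x (s / 2) (chart_map c y)) 0.
    rewrite B0 !mul0r big1 // => i _.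
    by rewrite CinfME (bE i).1 // B0 !mul0r.
  have yx : `|chart_map c y - x| < s.
    apply: le_lt_trans (bump_support s20 B0) _.
    by rewrite ltr_pdivrMr // ltr_pMr // ltr1n.
  have FE (p' : M) : chart_dom c p' -> F (chart_map c p') = f p'.
    by move=> cz; rewrite /F /= chart_mapK.
  have := hadamard SF yx; rewrite !FE // => ->.
  rewrite mulr_sumr; apply: eq_bigr => i _.
  rewrite (CinfME (b i)) (bE i).1 // (HE i).1 // !fctE /=; ring.
(* The bump function [Psi] is centred at [p], whereas [chi] is arbitrary and may vanish there. This
   identity trades the localized coordinates [b i] for the given [a i]. *)
have E2 i : chi * b i = Psi * (a i - Cinf_cst M (x 0 i) * chi).
  apply: CinfP => y; rewrite !CinfME.
  have [cy|cy] := pselect (chart_dom c y); last first.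
    by rewrite Psi0 // (bE i).2 // mulr0 mul0r.
  rewrite Psi1 // (bE i).1 // CinfDE CinfNE CinfME aE // !fctE ?Cinf_cstE; ring.
have Xb i : chi p * X (b i) p = Psi p * (X (a i) p - x 0 i * X chi p).
  have := congr1 (fun h => X h p) (E2 i); rewrite !vfM vfD vfN vfM vfC.
  rewrite !CinfDE !CinfME !CinfDE !CinfNE !CinfDE !CinfME bp aE // -/x Cinf_cstE Cinf0E.
  rewrite mulr0 add0r => ->; ring.
(* Since [b i] vanishes at [p], the Leibniz rule leaves only the value of [H i] there, so no
   derivative of the Hadamard coefficients survives. *)
have XF : Psi p * Psi p * X f p = \sum_i X (b i) p * (Psi p * 'D_(delta_mx 0 i) F x).
  have := congr1 (fun h => X h p) E1; rewrite vf_sum !vfM vfD vfN vfC Cinf_sumE.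
  rewrite !CinfDE !CinfME !CinfDE CinfNE Cinf_cstE subrr mulr0 add0r.
  rewrite CinfNE Cinf0E oppr0 addr0 => ->.
  by apply: eq_bigr => i _; rewrite vfM CinfDE !CinfME bp mul0r addr0 Hp.
have P2 : Psi p * Psi p != 0 by rewrite mulf_neq0.
apply: (mulfI P2); rewrite CinfME CinfXE mulrCA XF !mulr_sumr; apply: eq_bigr => i _.
rewrite CinfDE CinfNE !CinfME aE // -/x.
transitivity (chi p * (chi p * X (b i) p) * (Psi p * 'D_(delta_mx 0 i) F x)); first by ring.
rewrite Xb; ring.
Qed.

(* Division-free local frames: where [kappa] does not vanish, [E] is a frame with
   dual coframe [omega / kappa]. *)
Definition local_frame (kappa : Cinf M) (E : 'I_m -> vfield M)
    (omega : 'I_m -> vfield M -> Cinf M) : Prop :=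
  [/\ forall X, kappa *: X = \sum_i omega i X *: E i,
      forall i j, omega j (E i) = if i == j then kappa else 0,
      forall i, scalar (omega i) &
      forall i X p, (forall f, X f p = 0) -> omega i X p = 0].

Lemma exists_local_frame p : exists (kappa : Cinf M) E omega,
  kappa p != 0 /\ local_frame kappa E omega.
Proof.
have [c ac cp] := atlas_cover p; set x := chart_map c p.
have [s s0 sc] := chart_closed_ball cp.
have oB : open (nball x s) by exact: open_norm_ball.
have s20 : 0 < s / 2 by rewrite divr_gt0.
have [chi [chi1 chi0]] := cut_exists ac s0 sc (fun k => Ck_on_cst k (nball x s) 1).
have Sa i : smooth_on (nball x s) (fun z : 'rV[R]_m => z 0 i).
  by move=> k; exact: Ck_on_coord.
have [a aE] := choice (fun i => cut_exists ac s0 sc (Sa i)).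
have aC j y : chart_dom c y -> a j y = chi y * chart_map c y 0 j.
  by move=> cy; rewrite (aE j).1 // chi1 // mulr1.
have SD i f : smooth_on (nball x s) ('D_(delta_mx 0 i) (f \o chart_inv c)).
  by apply: smooth_on_derive; exact: smooth_on_sub sc (Cinf_smooth_on f ac).
pose dF i f y := 'D_(delta_mx 0 i) (f \o chart_inv c) (chart_map c y).
have [G GE] := choice (fun if' : 'I_m * Cinf M => cut_exists ac s0 sc (SD if'.1 if'.2)).
have G1 i f y : chart_dom c y -> G (i, f) y = chi y * dF i f y.
  by move=> cy; rewrite (GE (i, f)).1 // chi1 // mulr1.
have G0 i f y : ~ chart_dom c y -> G (i, f) y = 0 by move=> cy; rewrite (GE (i, f)).2.
have df i f y : chart_dom c y -> derivable (f \o chart_inv c) (chart_map c y) (delta_mx 0 i).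
  by move=> cy; apply: smooth_on_derivable (Cinf_smooth_on f ac) (chart_img cy).
have DE i : (fun f => G (i, f)) \in derivation M.
  apply/asboolP; split=> [b f h|f h]; apply: CinfP => y.
    have [cy|cy] := pselect (chart_dom c y); last first.
      by rewrite CinfDE CinfME !G0 // mulr0 addr0.
    rewrite CinfDE CinfME !G1 // Cinf_cstE /dF.
    have -> : (Cinf_cst M b * f + h : Cinf M) \o chart_inv c =
        b \*: (f \o chart_inv c) + (h \o chart_inv c) by [].
    rewrite deriveD ?deriveZ; [|exact: df|exact/derivableZ/df|exact: df].
    rewrite -[_ *: _]/(_ * _); ring.
  have [cy|cy] := pselect (chart_dom c y); last first.
    by rewrite CinfDE !CinfME !G0 // mulr0 mul0r addr0.
  rewrite CinfDE !CinfME !G1 // /dF.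
  have -> : (f * h : Cinf M) \o chart_inv c =
      (f \o chart_inv c) * (h \o chart_inv c) by [].
  rewrite deriveM; [|exact: df|exact: df].
  rewrite /= chart_mapK // -![_ *: _]/(_ * _); ring.
pose E i := MkVfield (DE i).
have EE i f : E i f = G (i, f) by [].
(* By the quotient rule this is [chi ^+ 2] times the derivative along [X] of the coordinate
   [a i / chi]. As [E i] is [chi] times a coordinate field, the common factor is [chi ^+ 3]. *)
pose omega i X := chi * X (a i) - a i * X chi.
exists (chi ^+ 3), E, omega; split.
  by rewrite CinfXE expf_neq0 // chi1 // mulr1 bump_center.
split.
- move=> X; apply: vfieldP => f y; rewrite vfZE vf_sumE Cinf_sumE.
  have [cy|cy] := pselect (chart_dom c y); last first.
    rewrite CinfME CinfXE chi0 // expr0n mul0r big1 // => i _.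
    by rewrite vfZE EE CinfME G0 // mulr0.
  rewrite exprS -mulrA CinfME (vfield_chart X f ac cy aC) mulr_sumr.
  by apply: eq_bigr => i _; rewrite vfZE EE CinfME G1 // mulrCA.
- move=> i j; apply: CinfP => y; rewrite /omega CinfDE CinfNE !CinfME !EE.
  have [cy|cy] := pselect (chart_dom c y); last first.
    by rewrite !G0 // !mulr0 subr0; case: ifP; rewrite ?CinfXE ?chi0 // expr0n.
  have -> : (if i == j then chi ^+ 3 else 0 : Cinf M) y = chi y ^+ 3 * (j == i)%:R.
    by rewrite eq_sym; case: eqP => _; rewrite ?mulr1 ?mulr0 ?CinfXE.
  rewrite !G1 // aC // /dF.
  have -> : 'D_(delta_mx 0 i) (a j \o chart_inv c) (chart_map c y) =
      'D_(delta_mx 0 i) ((chi \o chart_inv c) * (fun z : 'rV[R]_m => z 0 j)) (chart_map c y).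
    apply: near_eq_derive.
    apply: filterS (open_nbhs_nbhs (conj (@chart_img_open _ _ _ c) (chart_img cy))) => z cz.
    by have [dz zE] := chart_invP cz; rewrite /= aC // zE.
  have [dj Dj] := is_derive_coord i j (chart_map c y).
  rewrite deriveM; [rewrite Dj|exact: df|exact: dj].
  rewrite /= chart_mapK // -![_ *: _]/(_ * _); ring.
- move=> i b X Y; rewrite /omega !vfDE !vfZE /=; ring.
- move=> i X y X0; rewrite /omega CinfDE CinfNE !CinfME !X0; ring.
Qed.

End LocalFrames.

(** * Traces of tensorial endomorphisms *)

Section LinearMaps.
Context {R : realType} {m : nat} {M : manifold R m}.
Implicit Types (X Y Z : vfield M) (F G : vfield M -> vfield M) (l : vfield M -> Cinf M).
Implicit Types (a : Cinf M).

Lemma form0 l : scalar l -> l 0 = 0.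
Proof. by move=> ll; have := ll (-1) 0 0; rewrite scaler0 add0r mulN1r addNr. Qed.

Lemma formZ l a X : scalar l -> l (a *: X) = a * l X.
Proof. by move=> ll; have := ll a X 0; rewrite addr0 form0 // addr0. Qed.

Lemma formD l X Y : scalar l -> l (X + Y) = l X + l Y.
Proof. by move=> ll; have := ll 1 X Y; rewrite scale1r mul1r. Qed.

Lemma formN l X : scalar l -> l (- X) = - l X.
Proof. by move=> ll; rewrite -scaleN1r formZ // mulN1r. Qed.

Lemma form_sum l (I : Type) (r : seq I) (P : pred I) (V : I -> vfield M) :
  scalar l -> l (\sum_(i <- r | P i) V i) = \sum_(i <- r | P i) l (V i).
Proof.
move=> ll; apply: (big_morph l) => [X Y|]; [exact: formD|exact: form0].
Qed.

Lemma endo0 F : linear F -> F 0 = 0.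
Proof. by move=> lF; have := lF (-1) 0 0; rewrite scaler0 add0r scaleN1r addNr. Qed.

Lemma endoZ F a X : linear F -> F (a *: X) = a *: F X.
Proof. by move=> lF; have := lF a X 0; rewrite addr0 endo0 // addr0. Qed.

Lemma endoD F X Y : linear F -> F (X + Y) = F X + F Y.
Proof. by move=> lF; have := lF 1 X Y; rewrite !scale1r. Qed.

Lemma endo_sum F (I : Type) (r : seq I) (P : pred I) (V : I -> vfield M) :
  linear F -> F (\sum_(i <- r | P i) V i) = \sum_(i <- r | P i) F (V i).
Proof.
move=> lF; apply: (big_morph F) => [X Y|]; [exact: endoD|exact: endo0].
Qed.

Lemma rank1_linear l Y : scalar l -> linear (fun X => l X *: Y).
Proof. by move=> ll a X Z; rewrite ll scalerDl scalerA. Qed.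

Lemma scale_linear a F : linear F -> linear (fun X => a *: F X).
Proof. by move=> lF b X Y; rewrite lF scalerDr !scalerA mulrC. Qed.

Lemma add_linear F G : linear F -> linear G ->
  linear (fun X => F X + G X).
Proof. by move=> lF lG a X Y; rewrite lF lG scalerDr addrACA. Qed.

Lemma opp_linear F : linear F -> linear (fun X => - F X).
Proof. by move=> lF a X Y; rewrite lF opprD scalerN. Qed.

Lemma linear_sum_fun (I : Type) (r : seq I) (F : I -> vfield M -> vfield M) :
  (forall i, linear (F i)) -> linear (fun X => \sum_(i <- r) F i X).
Proof.
move=> lF a X Y; rewrite scaler_sumr -big_split; apply: eq_bigr => i _.
exact: lF.
Qed.

End LinearMaps.

Section Trace.
Context {R : realType} {m : nat} {M : manifold R m}.
Implicit Types (X Y Z : vfield M) (F G : vfield M -> vfield M) (p : M) (f : Cinf M).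

Section Frame.
Variables (p : M) (kappa : Cinf M) (E : 'I_m -> vfield M).
Variables (omega : 'I_m -> vfield M -> Cinf M).
Hypotheses (kp : kappa p != 0) (frameE : local_frame kappa E omega).

Lemma frame_linear i : scalar (omega i). Proof. by case: frameE => _ _ + _; apply. Qed.

Lemma frame_expand X : kappa *: X = \sum_i omega i X *: E i.
Proof. by case: frameE. Qed.

Lemma frame_dual i j : omega j (E i) = if i == j then kappa else 0.
Proof. by case: frameE. Qed.

Definition frame_coord X : 'cV[R]_m := \col_i (omega i X p / kappa p).

Lemma frame_coordE X f : X f p = \sum_i frame_coord X i 0 * E i f p.
Proof.
apply: (mulfI kp); rewrite mulr_sumr.
have := congr1 (fun Y : vfield M => Y f p) (frame_expand X).
rewrite vfZE CinfME vf_sumE Cinf_sumE => ->; apply: eq_bigr => i _.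
by rewrite vfZE CinfME mxE mulrA mulrCA divff // mulr1.
Qed.

Lemma frame_scalarE (l : vfield M -> Cinf M) X : scalar l ->
  l X p = \sum_i frame_coord X i 0 * l (E i) p.
Proof.
move=> ll; apply: (mulfI kp); rewrite mulr_sumr -CinfME -formZ //.
rewrite frame_expand form_sum // Cinf_sumE; apply: eq_bigr => i _.
by rewrite formZ // CinfME mxE mulrA mulrCA divff // mulr1.
Qed.

Lemma frame_linearE F X f : linear F ->
  F X f p = \sum_i frame_coord X i 0 * F (E i) f p.
Proof.
move=> lF; apply: (frame_scalarE (l := fun X => F X f)) => a Y Z.
by rewrite lF vfDE vfZE.
Qed.

Lemma frame_coord_unique X (c : 'cV[R]_m) :
  (forall f, X f p = \sum_i c i 0 * E i f p) -> frame_coord X = c.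
Proof.
move=> Xc; pose Y := X - \sum_i Cinf_cst M (c i 0) *: E i.
have Y0 f : Y f p = 0.
  rewrite vfDE vfNE CinfDE CinfNE Xc vf_sumE Cinf_sumE; apply/eqP.
  by rewrite subr_eq0; apply/eqP/eq_bigr => i _; rewrite vfZE CinfME.
apply/matrixP => j k; rewrite ord1 mxE; have [_ _ _ /(_ j Y p Y0)] := frameE.
have lj := frame_linear j.
rewrite formD // formN // form_sum // CinfDE CinfNE Cinf_sumE.
rewrite (bigD1 j) //= big1 => [|i ij].
  rewrite formZ // frame_dual eqxx CinfME addr0 => /eqP.
  by rewrite subr_eq0 => /eqP ->; rewrite mulfK.
by rewrite formZ // frame_dual (negbTE ij) mulr0.
Qed.

Definition frame_mx F : 'M[R]_m := \matrix_(i, j) frame_coord (F (E j)) i 0.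

Lemma frame_mxE F i j : frame_mx F i j = omega i (F (E j)) p / kappa p.
Proof. by rewrite !mxE. Qed.

Lemma frame_basis : basis_at p E.
Proof.
move=> X; exists (frame_coord X)^T; split.
  by move=> f; rewrite frame_coordE; apply: eq_bigr => i _; rewrite [in RHS]mxE.
move=> c Xc; rewrite (@frame_coord_unique X c^T) ?trmxK // => f.
by rewrite Xc; apply: eq_bigr => i _; rewrite mxE.
Qed.

Lemma frame_is_trace F : is_trace_at F p (\tr (frame_mx F)).
Proof.
exists E, (frame_mx F); split => //; first exact: frame_basis.
by move=> j f; rewrite frame_coordE; apply: eq_bigr => i _; rewrite [in RHS]mxE.
Qed.

Lemma frame_coord_comb n X (d : 'I_n -> R) (V : 'I_n -> vfield M) i :
  (forall f, X f p = \sum_k d k * V k f p) ->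
  frame_coord X i 0 = \sum_k frame_coord (V k) i 0 * d k.
Proof.
move=> XV; rewrite (@frame_coord_unique X (\col_i \sum_k frame_coord (V k) i 0 * d k)).
  by rewrite mxE.
move=> f; rewrite XV; under eq_bigr do rewrite frame_coordE mulr_sumr.
rewrite exchange_big; apply: eq_bigr => j _; rewrite [in RHS]mxE mulr_suml.
by apply: eq_bigr => k _; ring.
Qed.

(** [trace] may have chosen any basis of the tangent space at [p], so all choices have to give the
    same number. [P] and [Qm] are the two changes of basis, and they conjugate [A'] into the frame
    matrix. *)
Lemma frame_is_trace_unique F t : linear F -> is_trace_at F p t -> t = \tr (frame_mx F).
Proof.
move=> lF [E' [A' [bE' FE' ->]]].
have [Q QE] := choice (fun i => bE' (E i)).
pose Qm : 'M[R]_m := \matrix_(j, i) Q i 0 j.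
pose P : 'M[R]_m := \matrix_(i, j) frame_coord (E' j) i 0.
have PQ : P *m Qm = 1%:M.
  apply/matrixP => i j; rewrite !mxE.
  transitivity (frame_coord (E j) i 0).
    rewrite (frame_coord_comb i (QE j).1).
    by apply: eq_bigr => k _; rewrite [P _ _]mxE [Qm _ _]mxE.
  by rewrite mxE frame_dual eq_sym; case: eqP; rewrite ?divff // mul0r.
have AP : frame_mx F *m P = P *m A'.
  apply/matrixP => i j; rewrite !mxE.
  transitivity (frame_coord (F (E' j)) i 0).
    rewrite (frame_coord_comb i (fun f => frame_linearE (E' j) f lF)).
    by apply: eq_bigr => k _; rewrite [frame_mx F _ _]mxE [P _ _]mxE.
  rewrite (frame_coord_comb i (FE' j)).
  by apply: eq_bigr => k _; rewrite [P _ _]mxE.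
have -> : frame_mx F = P *m A' *m Qm by rewrite -AP -mulmxA PQ mulmx1.
by rewrite mxtrace_mulC mulmxA (mulmx1C PQ) mul1mx.
Qed.

Lemma frame_trace F : linear F -> trace F p = \tr (frame_mx F).
Proof.
move=> lF; rewrite /trace; case: xgetP => [t _ /=|/(_ (\tr (frame_mx F)))[]].
  exact: frame_is_trace_unique.
exact: frame_is_trace.
Qed.

Lemma frame_mx_comp F G : linear F -> frame_mx (F \o G) = frame_mx F *m frame_mx G.
Proof.
move=> lF; apply/matrixP => i j; rewrite [LHS]mxE [RHS]mxE /=.
rewrite (frame_coord_comb i (fun f => frame_linearE (G (E j)) f lF)).
by apply: eq_bigr => k _; rewrite [frame_mx F _ _]mxE [frame_mx G _ _]mxE.
Qed.

End Frame.

Lemma traceD F G p : linear F -> linear G ->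
  trace (fun X => F X + G X) p = trace F p + trace G p.
Proof.
move=> lF lG; have [k [E [w [kp fr]]]] := exists_local_frame p.
have lFG := add_linear lF lG.
rewrite !(frame_trace kp fr) // -mxtraceD; congr (\tr _).
apply/matrixP => i j; rewrite [RHS]mxE !frame_mxE.
by rewrite (formD _ _ (frame_linear fr i)) CinfDE mulrDl.
Qed.

Lemma traceZ (a : Cinf M) F p : linear F ->
  trace (fun X => a *: F X) p = a p * trace F p.
Proof.
move=> lF; have [k [E [w [kp fr]]]] := exists_local_frame p.
have laF := scale_linear a lF.
rewrite !(frame_trace kp fr) // -mxtraceZ; congr (\tr _).
apply/matrixP => i j; rewrite [RHS]mxE !frame_mxE.
by rewrite (formZ _ _ (frame_linear fr i)) CinfME mulrA.
Qed.

Lemma traceN F p : linear F -> trace (fun X => - F X) p = - trace F p.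
Proof.
move=> lF; rewrite -mulN1r -(traceZ (-1)) //.
by congr (trace _ p); apply/funext => X; rewrite scaleN1r.
Qed.

Lemma traceB F G p : linear F -> linear G ->
  trace (fun X => F X - G X) p = trace F p - trace G p.
Proof.
by move=> lF lG; rewrite traceD ?traceN //; exact: opp_linear.
Qed.

Lemma trace_comp F G p : linear F -> linear G -> trace (F \o G) p = trace (G \o F) p.
Proof.
move=> lF lG; have [k [E [w [kp fr]]]] := exists_local_frame p.
have lFG : linear (F \o G) by move=> a X Y /=; rewrite lG lF.
have lGF : linear (G \o F) by move=> a X Y /=; rewrite lF lG.
rewrite (frame_trace kp fr lFG) (frame_trace kp fr lGF).
by rewrite (frame_mx_comp kp fr G lF) (frame_mx_comp kp fr F lG) mxtrace_mulC.
Qed.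

Lemma trace_id p : trace (fun X : vfield M => X) p = m%:R.
Proof.
have [k [E [w [kp fr]]]] := exists_local_frame p.
rewrite (frame_trace kp fr) // -mxtrace1; congr (\tr _).
apply/matrixP => i j; rewrite frame_mxE (frame_dual fr) [RHS]mxE eq_sym.
by case: eqP; rewrite ?divff // mul0r.
Qed.

Lemma trace_rank1 (l : vfield M -> Cinf M) Y p : scalar l ->
  trace (fun X => l X *: Y) p = l Y p.
Proof.
move=> ll; have [k [E [w [kp fr]]]] := exists_local_frame p.
have lF := rank1_linear Y ll.
rewrite (frame_trace kp fr) // (frame_scalarE kp fr Y ll); apply: eq_bigr => i _.
rewrite frame_mxE mxE (formZ _ _ (frame_linear fr i)) CinfME.
by rewrite -mulrA mulrC.
Qed.

(** With the Gram matrix [Q] of the frame, adjointness reads [A^T *m Q = Q *m B]. Positivity makes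
    [Q] invertible, so [A^T] and [B] are similar. *)
Lemma trace_adjoint (g : riemannian_metric M) F G p : linear F -> linear G ->
  (forall X Y, g (F X) Y = g X (G Y)) -> trace F p = trace G p.
Proof.
move=> lF lG FG; have [k [E [w [kp fr]]]] := exists_local_frame p.
rewrite !(frame_trace kp fr) //.
set A := frame_mx p k E w F; set B := frame_mx p k E w G.
pose Q : 'M[R]_m := \matrix_(i, j) g (E i) (E j) p.
have lg Z : scalar (g ^~ Z) by exact: metric_linear.
have lg' Z : scalar (g Z).
  by move=> a X Y; rewrite !(Defs.metric_sym g Z) metric_linear.
have AQ : A^T *m Q = Q *m B.
  apply/matrixP => i j; rewrite !mxE.
  transitivity (g (F (E i)) (E j) p).
    rewrite (frame_scalarE kp fr _ (lg (E j))); apply: eq_bigr => l _.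
    by rewrite [A^T _ _]mxE [A _ _]mxE [Q _ _]mxE.
  rewrite FG (frame_scalarE kp fr _ (lg' (E i))); apply: eq_bigr => l _.
  by rewrite [B _ _]mxE [Q _ _]mxE mulrC.
have uQ : Q \in unitmx.
  rewrite -row_free_unit; apply: inj_row_free => v vQ.
  pose X := \sum_i Cinf_cst M (v 0 i) *: E i.
  have XE f : X f p = \sum_i v^T i 0 * E i f p.
    by rewrite vf_sumE Cinf_sumE; apply: eq_bigr => i _; rewrite vfZE CinfME mxE.
  have gXX : g X X p = 0.
    rewrite {1}/X (form_sum _ _ _ (lg X)) Cinf_sumE big1 // => i _.
    rewrite (formZ _ _ (lg X)) CinfME Cinf_cstE {1}/X (form_sum _ _ _ (lg' (E i))).
    have -> : (\sum_i0 g (E i) (Cinf_cst M (v 0 i0) *: E i0)) p = (v *m Q) 0 i.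
      rewrite Cinf_sumE mxE; apply: eq_bigr => l _.
      by rewrite (formZ _ _ (lg' (E i))) CinfME Cinf_cstE [Q _ _]mxE Defs.metric_sym.
    by rewrite vQ mxE mulr0.
  have X0 f : X f p = 0.
    apply/eqP/negPn/negP => Xf; have : 0 < g X X p by apply: metric_pos; exists f.
    by rewrite gXX ltxx.
  apply: trmx_inj; rewrite trmx0 -(frame_coord_unique kp fr XE).
  apply: (frame_coord_unique kp fr) => f.
  by rewrite X0 big1 // => i _; rewrite mxE mul0r.
by rewrite -(mxtrace_tr A) -(mulmxK uQ A^T) AQ mxtrace_mulC mulmxA mulVmx // mul1mx.
Qed.

Lemma trace0 p : trace (fun=> 0 : vfield M) p = 0.
Proof.
have -> : (fun=> 0 : vfield M) = (fun X => 0 *: X) by apply/funext => X; rewrite scale0r.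
by rewrite (traceZ 0) // Cinf0E mul0r.
Qed.

Lemma trace_sum (I : Type) (r : seq I) (F : I -> vfield M -> vfield M) p :
  (forall i, linear (F i)) ->
  trace (fun X => \sum_(i <- r) F i X) p = \sum_(i <- r) trace (F i) p.
Proof.
move=> lF; elim: r => [|i r IH].
  rewrite big_nil -(trace0 p); congr (trace _ p); apply/funext => X.
  by rewrite big_nil.
rewrite big_cons -IH -traceD //; last exact: linear_sum_fun.
by congr (trace _ p); apply/funext => X; rewrite big_cons.
Qed.

(** Rank-nullity at one point, extended to a global field with constant coefficients in the frame.
    It will supply a tangent vector orthogonal to three given ones. *)
Lemma exists_form_kernel k (l : 'I_k -> vfield M -> Cinf M) p : (k < m)%N ->
  (forall j, scalar (l j)) ->
  exists X, (exists f, X f p != 0) /\ forall j, l j X p = 0.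
Proof.
move=> km sl; have [kap [E [w [kp fr]]]] := exists_local_frame p.
pose C : 'M[R]_(m, k) := \matrix_(i, j) l j (E i) p.
have : kermx C != 0.
  rewrite -mxrank_eq0 mxrank_ker subn_eq0 -ltnNge.
  exact: leq_ltn_trans (rank_leq_col C) km.
move=> /rowV0Pn[v /sub_kermxP vC v0].
pose X := \sum_i Cinf_cst M (v 0 i) *: E i.
have XE f : X f p = \sum_i v^T i 0 * E i f p.
  by rewrite vf_sumE Cinf_sumE; apply: eq_bigr => i _; rewrite vfZE CinfME mxE.
exists X; split.
  apply: contrapT => X0; move/eqP: v0; apply; apply: trmx_inj.
  rewrite trmx0 -(frame_coord_unique kp fr XE); apply: (frame_coord_unique kp fr) => f.
  rewrite big1 => [|i _]; last by rewrite mxE mul0r.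
  by apply/eqP/negPn/negP => Xf; apply: X0; exists f.
move=> j; rewrite (form_sum _ _ _ (sl j)) Cinf_sumE.
transitivity ((v *m C) 0 j); last by rewrite vC mxE.
by rewrite mxE; apply: eq_bigr => i _; rewrite (formZ _ _ (sl j)) CinfME [C _ _]mxE.
Qed.

(* Covariantly differentiating [kappa *: Z = \sum_i omega i Z *: E i] gives
   [X kappa *: Z] as a sum of rank-one maps, whence the derivative of
   [kappa * trace F = \sum_i omega i (F (E i))]. *)
Lemma trace_derive (g : riemannian_metric M) nabla F (t : Cinf M) X p :
  levi_civita g nabla -> linear F -> (forall q, t q = trace F q) ->
  trace (fun Z => nabla X (F Z) - F (nabla X Z)) p = X t p.
Proof.
move=> [_ nD nZ _ _] lF tF; have [k [E [w [kp fr]]]] := exists_local_frame p.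
have lw i := frame_linear fr i.
have n_lin a Y Z : nabla X (a *: Y + Z) = X a *: Y + a *: nabla X Y + nabla X Z.
  by rewrite nD nZ.
have lDF : linear (fun Z => nabla X (F Z) - F (nabla X Z)).
  move=> a Y Z; rewrite lF !n_lin !(endoD _ _ lF) !(endoZ _ _ lF).
  by apply: vfield_eq => f; rewrite !(vfDE, vfNE, vfZE) /=; ring.
have ktr q G : k q != 0 -> linear G -> k q * trace G q = \sum_i w i (G (E i)) q.
  move=> kq lG; rewrite (frame_trace kq fr lG) mulr_sumr; apply: eq_bigr => i _.
  by rewrite frame_mxE mulrCA divff // mulr1.
pose theta i Z := X (w i Z) - w i (nabla X Z).
have lth i : scalar (theta i).
  move=> a Y Z; rewrite /theta n_lin lw !(formD _ _ (lw i)) !(formZ _ _ (lw i)) vfD vfM.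
  ring.
have E1 Z : X k *: Z = \sum_i (theta i Z *: E i + w i Z *: nabla X (E i)).
  have := congr1 (nabla X) (frame_expand fr Z); rewrite nZ.
  have -> : nabla X (\sum_i w i Z *: E i) = \sum_i (X (w i Z) *: E i + w i Z *: nabla X (E i)).
    have n0 : nabla X 0 = 0 by apply: (addrI (nabla X 0)); rewrite -nD !addr0.
    by rewrite (big_morph (nabla X) (nD X) n0); apply: eq_bigr => i _; rewrite nZ.
  rewrite (frame_expand fr (nabla X Z)) => /(canRL (addrK _)) ->.
  rewrite -sumrB; apply: eq_bigr => i _.
  by rewrite /theta scalerBl addrAC.
have E2 : X k p * t p = \sum_i (theta i (F (E i)) p + w i (F (nabla X (E i))) p).
  rewrite tF -traceZ //.
  have -> : (fun Z => X k *: F Z) = (fun Z => \sum_i (theta i Z *: F (E i) +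
      w i Z *: F (nabla X (E i)))).
    apply/funext => Z; rewrite -(endoZ _ _ lF) E1 (endo_sum _ _ _ lF).
    by apply: eq_bigr => i _; rewrite (endoD _ _ lF) !(endoZ _ _ lF).
  rewrite trace_sum => [|i].
    apply: eq_bigr => i _; rewrite traceD; [|exact: rank1_linear|exact: rank1_linear].
    by rewrite !trace_rank1.
  by apply: add_linear; exact: rank1_linear.
(* The frame computes the trace only where [k] is nonzero, so [s = 0] is known only there. But
   [k * s = 0] holds everywhere, and deriving it at [p], where [s] vanishes and [k] does not, gives
   [X s p = 0]. *)
pose s := k * t - \sum_i w i (F (E i)).
have sE q : k q != 0 -> s q = 0.
  move=> kq; rewrite /s CinfDE CinfNE CinfME tF ktr // Cinf_sumE subrr //.
have ks : k * s = 0.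
  apply: CinfP => q; rewrite CinfME; have [->|kq] := eqVneq (k q) 0; first by rewrite mul0r.
  by rewrite sE // mulr0.
have Xs : X s p = 0.
  have := congr1 (fun f => X f p) ks; rewrite vfM CinfDE !CinfME sE // mulr0 add0r vf0 Cinf0E.
  by move/eqP; rewrite mulf_eq0 (negbTE kp) => /eqP.
apply: (mulfI kp); rewrite ktr //.
have : X k p * t p + k p * X t p = \sum_i X (w i (F (E i))) p.
  move: Xs; rewrite /s vfD vfN vfM vf_sum CinfDE CinfNE CinfDE !CinfME Cinf_sumE.
  by move/eqP; rewrite subr_eq0 => /eqP.
rewrite E2 => /(canRL (addKr _)) ->; rewrite addrC -sumrB; apply: eq_bigr => i _.
rewrite (formD _ _ (lw i)) (formN _ (lw i)) CinfDE CinfNE /theta CinfDE CinfNE; ring.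
Qed.

End Trace.

(** * Levi-Civita connection and Kenmotsu manifolds *)

Section LeviCivita.
Context {R : realType} {m : nat} {M : manifold R m}.
Variables (g : riemannian_metric M) (nabla : vfield M -> vfield M -> vfield M).
Hypothesis LC : levi_civita g nabla.
Implicit Types (X Y Z W V : vfield M) (a f : Cinf M) (p : M).
Local Notation Rm := (curvature nabla).

Lemma metricDl X Y Z : g (X + Y) Z = g X Z + g Y Z.
Proof. exact: (formD X Y (metric_linear g Z)). Qed.
Lemma metricZl a X Z : g (a *: X) Z = a * g X Z.
Proof. exact: (formZ a X (metric_linear g Z)). Qed.
Lemma metricNl X Z : g (- X) Z = - g X Z.
Proof. exact: (formN X (metric_linear g Z)). Qed.
Lemma metricDr X Y Z : g Z (X + Y) = g Z X + g Z Y.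
Proof. by rewrite !(Defs.metric_sym g Z) metricDl. Qed.
Lemma metricZr a X Z : g Z (a *: X) = a * g Z X.
Proof. by rewrite !(Defs.metric_sym g Z) metricZl. Qed.
Lemma metricNr X Z : g Z (- X) = - g Z X.
Proof. by rewrite !(Defs.metric_sym g Z) metricNl. Qed.
Definition metricE := (metricDl, metricDr, metricNl, metricNr, metricZl, metricZr).

Lemma metric_eq0 X : g X X = 0 -> X = 0.
Proof.
move=> gX; apply: vfieldP => f p; apply/eqP/negPn/negP => Xf.
have : 0 < g X X p by apply: metric_pos; exists f.
by rewrite gX Cinf0E ltxx.
Qed.

Lemma nablaDl X Y Z : nabla (X + Y) Z = nabla X Z + nabla Y Z.
Proof. by case: LC => lin _ _ _ _; exact: (endoD X Y (lin Z)). Qed.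
Lemma nablaZl a X Z : nabla (a *: X) Z = a *: nabla X Z.
Proof. by case: LC => lin _ _ _ _; exact: (endoZ a X (lin Z)). Qed.
Lemma nablaNl X Z : nabla (- X) Z = - nabla X Z.
Proof. by rewrite -scaleN1r nablaZl scaleN1r. Qed.
Lemma nabla0l Z : nabla 0 Z = 0.
Proof. by have := nablaZl 0 0 Z; rewrite !scale0r. Qed.
Lemma nablaDr X Y Z : nabla Z (X + Y) = nabla Z X + nabla Z Y.
Proof. by case: LC => _ + _ _ _; apply. Qed.
Lemma nablaZr a X Z : nabla Z (a *: X) = Z a *: X + a *: nabla Z X.
Proof. by case: LC => _ _ + _ _; apply. Qed.
Lemma nabla0r Z : nabla Z 0 = 0.
Proof. by apply: (addrI (nabla Z 0)); rewrite -nablaDr !addr0. Qed.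
Lemma nablaNr X Z : nabla Z (- X) = - nabla Z X.
Proof. by apply/eqP; rewrite -addr_eq0 -nablaDr addNr nabla0r. Qed.
Definition nablaE := (nablaDl, nablaDr, nablaNl, nablaNr, nablaZl, nablaZr).

Lemma bracketE X Y : bracket X Y = nabla X Y - nabla Y X.
Proof. by case: LC => _ _ _ -> _. Qed.

Lemma nabla_metric X Y Z : X (g Y Z) = g (nabla X Y) Z + g Y (nabla X Z).
Proof. by case: LC => _ _ _ _; exact. Qed.

Lemma bracketNC X Y : bracket X Y = - bracket Y X.
Proof. by rewrite !bracketE opprB. Qed.

Lemma bracket_linear_l a X Y Z :
  bracket (a *: X + Y) Z = a *: bracket X Z - Z a *: X + bracket Y Z.
Proof. by vfield_ring. Qed.

Lemma jacobi X Y Z :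
  bracket (bracket X Y) Z + bracket (bracket Y Z) X + bracket (bracket Z X) Y = 0.
Proof. by vfield_ring. Qed.

Lemma curvatureNC X Y Z : Rm X Y Z = - Rm Y X Z.
Proof. by rewrite /curvature (bracketNC X Y) nablaNl opprK; vfield_ring. Qed.

Lemma curvature_linear1 Y Z : linear (fun X => Rm X Y Z).
Proof.
move=> a X W; rewrite /curvature bracket_linear_l !nablaE.
by vfield_ring.
Qed.

Lemma curvature_linear3 X Y : linear (Rm X Y).
Proof.
move=> a Z W; rewrite /curvature !nablaE.
by vfield_ring.
Qed.

Lemma bianchi1 X Y Z : Rm X Y Z + Rm Y Z X + Rm Z X Y = 0.
Proof.
have J : bracket X (bracket Y Z) + bracket Y (bracket Z X) + bracket Z (bracket X Y) = 0.
  by vfield_ring.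
rewrite -J /curvature !(bracketE _ (bracket _ _)) !(bracketE X Y, bracketE Y Z, bracketE Z X).
by rewrite !nablaE; vfield_ring.
Qed.

Lemma curvature_skew X Y Z W : g (Rm X Y Z) W = - g Z (Rm X Y W).
Proof.
have : X (Y (g Z W)) - Y (X (g Z W)) - bracket X Y (g Z W) = 0.
  by rewrite bracket_fun subrr.
rewrite !nabla_metric !vfD !nabla_metric /curvature !metricE => H.
by apply/eqP; rewrite -subr_eq0 -H; apply/eqP; ring.
Qed.

(** Pair symmetry is a linear consequence of the first Bianchi identity and the two skew symmetries.
    Evaluating at a point turns it into a linear system over [R]. *)
Lemma curvature_pair X Y Z W : g (Rm X Y Z) W = g (Rm Z W X) Y.
Proof.
have B A1 A2 A3 A4 p : g (Rm A1 A2 A3) A4 p + g (Rm A2 A3 A1) A4 p + g (Rm A3 A1 A2) A4 p = 0.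
  by rewrite -!CinfDE -!metricDl bianchi1 -(scale0r (0 : vfield M)) metricZl mul0r.
have S A1 A2 A3 A4 p : g (Rm A1 A2 A3) A4 p = - g (Rm A1 A2 A4) A3 p.
  by rewrite curvature_skew Defs.metric_sym.
have N A1 A2 A3 A4 p : g (Rm A1 A2 A3) A4 p = - g (Rm A2 A1 A3) A4 p.
  by rewrite curvatureNC metricNl.
apply: CinfP => p.
have := B X Y Z W p; have := B Y Z W X p; have := B Z W X Y p; have := B W X Y Z p.
have := S Y Z W X p; have := S Z X Y W p; have := S X Y W Z p; have := S W Y X Z p.
have := S Z W Y X p; have := S Y Z X W p; have := S W X Z Y p; have := S W X Y Z p.
have := N W Y X Z p; have := N Y W X Z p; have := N Z X Y W p; have := N X Z Y W p.
have := N W X Z Y p; have := N X W Y Z p; have := N X Z W Y p; have := S X Z W Y p.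
have := S Y W Z X p; have := N Y W Z X p;
have := S W Y Z X p; have := S X Z Y W p; have := S Z X W Y p.
lra.
Qed.

(** The form [d^nabla Rm = 0] of the second Bianchi identity: only the endomorphism is
    differentiated, not the arguments of the 2-form, and the bracket terms make up for it. Traced
    against [phi], it is an identity for an exterior derivative. It reduces to the Jacobi identity
    for operators and for brackets. *)
Lemma bianchi2 W X Y Z :
  (nabla W (Rm X Y Z) - Rm X Y (nabla W Z)) +
  (nabla X (Rm Y W Z) - Rm Y W (nabla X Z)) +
  (nabla Y (Rm W X Z) - Rm W X (nabla Y Z)) =
  Rm (bracket W X) Y Z + Rm (bracket X Y) W Z + Rm (bracket Y W) X Z.
Proof.
have J : nabla (bracket (bracket W X) Y) Z + nabla (bracket (bracket X Y) W) Z +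
    nabla (bracket (bracket Y W) X) Z = 0.
  by rewrite -!nablaDl jacobi nabla0l.
rewrite /curvature !nablaE.
apply: vfield_eq => f; have := congr1 (fun V : vfield M => V f) J.
vf_simp => Jf; apply/eqP; rewrite -subr_eq0 -Jf; apply/eqP; ring.
Qed.

End LeviCivita.

(** * Covariant derivatives and curvature identities on a Kenmotsu manifold *)

Section Kenmotsu.
Context {R : realType} {m : nat} {M : manifold R m}.
Variables (K : almost_contact_metric M) (nabla : vfield M -> vfield M -> vfield M).
Hypotheses (LC : levi_civita (acm_metric K) nabla) (KM : kenmotsu K nabla).
Implicit Types (X Y Z W V : vfield M) (a f : Cinf M) (p : M).
Local Notation Rm := (curvature nabla).
Local Notation phi := (acm_phi K).
Local Notation xi := (acm_xi K).
Local Notation eta := (acm_eta K).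
Local Notation g := (acm_metric K).

Lemma etaD X Y : eta (X + Y) = eta X + eta Y. Proof. exact: raddfD. Qed.
Lemma etaN X : eta (- X) = - eta X. Proof. exact: raddfN. Qed.
Lemma etaZ a X : eta (a *: X) = a * eta X. Proof. exact: linearZ. Qed.
Definition etaE := (etaD, etaN, etaZ).
Lemma phiD X Y : phi (X + Y) = phi X + phi Y. Proof. exact: raddfD. Qed.
Lemma phiN X : phi (- X) = - phi X. Proof. exact: raddfN. Qed.
Lemma phiZ a X : phi (a *: X) = a *: phi X. Proof. exact: linearZ. Qed.
Definition phiE := (phiD, phiN, phiZ).

Lemma phi_xi : phi xi = 0.
Proof.
have h1 : phi (phi xi) = 0 by rewrite acm_phi2 acm_eta_xi scale1r addNr.
have h2 : phi xi = eta (phi xi) *: xi.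
  have := acm_phi2 K (phi xi); rewrite h1 raddf0 => /esym/eqP.
  by rewrite addrC subr_eq0 => /eqP.
move: h2; set c := eta (phi xi) => h2.
(* [Cinf M] has no nilpotents, so a vanishing square suffices to get [c = 0]. *)
have h3 : c * c = 0.
  have := congr1 eta h1; rewrite h2 phiZ h2 !etaZ acm_eta_xi mulr1 => ->.
  exact: raddf0.
rewrite h2 (_ : c = 0) ?scale0r //.
apply: CinfP => p; apply/eqP.
by have /eqP := congr1 (fun f : Cinf M => f p) h3; rewrite CinfME mulf_eq0 orbb.
Qed.

Lemma metric_xi X : g X xi = eta X.
Proof.
have := acm_compat K X xi; rewrite phi_xi acm_eta_xi mulr1 => H.
apply/eqP; rewrite -subr_eq0 -H.
by have := metricZr g 0 0 (phi X); rewrite scale0r mul0r => ->.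
Qed.

Lemma metric_xil X : g xi X = eta X.
Proof. by rewrite Defs.metric_sym metric_xi. Qed.

Lemma eta_phi X : eta (phi X) = 0.
Proof.
have h1 : phi (phi (phi X)) = - phi X.
  by rewrite (acm_phi2 K X) !phiE phi_xi scaler0 addr0.
have : eta (phi X) *: xi = 0.
  by apply: (addrI (- phi X)); rewrite addr0 -(acm_phi2 K (phi X)).
by move/(congr1 eta); rewrite etaZ acm_eta_xi mulr1 raddf0.
Qed.

Lemma metric_phil X Y : g (phi X) Y = - g X (phi Y).
Proof.
have := acm_compat K X (phi Y); rewrite acm_phi2 eta_phi mulr0 subr0 !metricE.
by rewrite metric_xi eta_phi mulr0 addr0 => <-; rewrite opprK.
Qed.

Lemma nabla_phi X Y : nabla X (phi Y) =
  phi (nabla X Y) + g (phi X) Y *: xi - eta Y *: phi X.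
Proof. by have /eqP := KM X Y; rewrite subr_eq => /eqP ->; rewrite addrC addrA. Qed.

Lemma vf1 X : X (1 : Cinf M) = 0.
Proof.
have -> : (1 : Cinf M) = Cinf_cst M 1 by apply: CinfP.
exact: vfC.
Qed.

(** [phi] determines a field up to its [xi] component. The Kenmotsu condition at [Y = xi] gives
    [phi (nabla X xi) = phi X], and the constant length of [xi] fixes the remaining component. *)
Lemma nabla_xi X : nabla X xi = X - eta X *: xi.
Proof.
have h1 : phi (nabla X xi) = phi X.
  have := KM X xi; rewrite phi_xi (nabla0r LC) metric_xi eta_phi scale0r acm_eta_xi.
  by rewrite scale1r !sub0r => /oppr_inj.
have h2 : eta (nabla X xi) = 0.
  have := nabla_metric LC X xi xi; rewrite !metric_xi metric_xil acm_eta_xi vf1 => /esym.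
  move=> h; apply: CinfP => p; have := congr1 (fun f : Cinf M => f p) h.
  by rewrite CinfDE Cinf0E; lra.
have := congr1 phi h1; rewrite !acm_phi2 h2 scale0r addr0.
by move/(congr1 -%R); rewrite opprK opprD opprK.
Qed.

Lemma nabla_eta X Y : X (eta Y) = eta (nabla X Y) + g X Y - eta X * eta Y.
Proof.
rewrite -metric_xi (nabla_metric LC) nabla_xi !metricE !metric_xi (Defs.metric_sym g Y X).
ring.
Qed.

Lemma curvature_xi X Y : Rm X Y xi = eta X *: Y - eta Y *: X.
Proof.
rewrite /curvature !nabla_xi !(nablaE LC) !nabla_xi !(bracketE LC) !etaE !nabla_eta.
rewrite (Defs.metric_sym g Y X); vfield_ring.
Qed.

Lemma curvature_phi X Y Z : Rm X Y (phi Z) = phi (Rm X Y Z) +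
  g Y Z *: phi X - g X Z *: phi Y + g X (phi Z) *: Y - g Y (phi Z) *: X.
Proof.
rewrite /curvature !nabla_phi !(nablaE LC) !nabla_phi !nabla_xi !(bracketE LC).
rewrite !(nabla_metric LC) !nabla_phi !nabla_eta.
rewrite ?phiE ?etaE ?metricE ?metric_phil ?metric_xi ?metric_xil ?eta_phi.
vfield_ring.
Qed.

End Kenmotsu.

(** * Ricci and star-Ricci tensors in the eta-Einstein case *)

Section KenmotsuRicci.
Context {R : realType} {m : nat} {M : manifold R m}.
Variables (K : almost_contact_metric M) (nabla : vfield M -> vfield M -> vfield M).
Hypotheses (LC : levi_civita (acm_metric K) nabla) (KM : kenmotsu K nabla).
Implicit Types (X Y Z W V : vfield M) (a f : Cinf M) (p : M).
Local Notation Rm := (curvature nabla).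
Local Notation phi := (acm_phi K).
Local Notation xi := (acm_xi K).
Local Notation eta := (acm_eta K).
Local Notation g := (acm_metric K).

Lemma phi_linear : linear phi. Proof. exact: linearP. Qed.

Lemma phi_comp_linear (F : vfield M -> vfield M) : linear F -> linear (fun X => phi (F X)).
Proof. by move=> lF a X Y; rewrite lF linearP. Qed.

Lemma eta_scalar : scalar eta. Proof. exact: linearP. Qed.

Lemma ricci_xi Y p : ricci nabla Y xi p = (1 - m%:R) * eta Y p.
Proof.
rewrite /ricci.
have -> : (fun X => Rm X Y xi) = (fun X => eta X *: Y - eta Y *: X).
  by apply/funext => X; exact: curvature_xi.
rewrite traceB ?(traceZ (eta Y) (F := id)) ?trace_rank1 ?trace_id //.
- by rewrite mulrBl mul1r mulrC.
- exact: eta_scalar.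
- exact: rank1_linear eta_scalar.
- exact: scale_linear.
Qed.

Lemma trace_phi p : trace phi p = 0.
Proof.
have : trace phi p = trace (fun X => - phi X) p.
  apply: (trace_adjoint (g := g)); [exact: phi_linear|exact/opp_linear/phi_linear|].
  by move=> X Y; rewrite metricNr metric_phil.
rewrite traceN; last exact: phi_linear.
lra.
Qed.

Local Notation B Y Z p := (trace (fun X => phi (Rm X Y Z)) p).

Lemma phi_curvature_linear Y Z : linear (fun X => phi (Rm X Y Z)).
Proof. exact/phi_comp_linear/(curvature_linear1 LC). Qed.

(** Contraction of [curvature_phi]: the term in [phi X] is traceless, each of the two rank-one terms
    contributes [g Y (phi Z)], and the multiple of the identity contributes [- m] times it. *)
Lemma ricci_phi Y Z p :
  ricci nabla Y (phi Z) p = B Y Z p + (2 - m%:R) * g Y (phi Z) p.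
Proof.
rewrite /ricci.
have -> : (fun X => Rm X Y (phi Z)) = (fun X => phi (Rm X Y Z) +
    (g Y Z *: phi X + (- (g X Z *: phi Y) + (g X (phi Z) *: Y + - (g Y (phi Z) *: X))))).
  by apply/funext => X; rewrite (curvature_phi LC) // !addrA.
have l1 := phi_curvature_linear Y Z.
have l2 := scale_linear (g Y Z) phi_linear.
have s3 : scalar (g ^~ Z) by exact: metric_linear.
have l3 := opp_linear (rank1_linear (phi Y) s3).
have s4 : scalar (g ^~ (phi Z)) by exact: metric_linear.
have l4 := rank1_linear Y s4.
have l5' : linear (fun X => g Y (phi Z) *: X) by exact: (@scale_linear _ _ _ _ id).
have l5 := opp_linear l5'.
rewrite traceD //; last by do ! apply: add_linear.
rewrite traceD //; last by do ! apply: add_linear.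
rewrite traceD //; last by do ! apply: add_linear.
rewrite traceD // traceZ; last exact: phi_linear.
rewrite trace_phi mulr0 add0r traceN; last exact: rank1_linear.
rewrite trace_rank1 // trace_rank1 // traceN // (traceZ (g Y (phi Z)) (F := id)) // trace_id.
rewrite metric_phil CinfNE; ring.
Qed.

(** By pair symmetry the metric adjoint of [X |-> phi (Rm X Y Z)] is [X |-> - Rm (phi X) Z Y], and
    cyclicity of the trace moves [phi] back to the left. *)
Lemma trace_phi_curvature_skew Y Z p : B Y Z p = - B Z Y p.
Proof.
have l1 := curvature_linear1 LC Z Y.
have lc : linear ((fun X => Rm X Z Y) \o phi) by move=> a X W /=; rewrite linearP l1.
transitivity (trace (fun X => - ((fun X => Rm X Z Y) \o phi) X) p).
  apply: (trace_adjoint (g := g)); [exact: phi_curvature_linear|exact: opp_linear|].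
  move=> X W /=; rewrite metric_phil (curvature_pair LC) -(curvatureNC LC).
  by rewrite (curvature_skew LC) opprK.
by rewrite traceN // trace_comp //; exact: phi_linear.
Qed.

(* Tracing the first Bianchi identity composed with [phi]. *)
Lemma trace_curvature_phi Y Z p :
  trace (fun X => phi (Rm Y Z X)) p = - 2 * B Y Z p.
Proof.
have : trace (fun X => phi (Rm X Y Z) + (phi (Rm Y Z X) + - phi (Rm X Z Y))) p = 0.
  rewrite -(trace0 (M := M) p); congr (trace _ p); apply/funext => X.
  rewrite -phiN -!phiD -(curvatureNC LC) addrA (bianchi1 LC); exact: raddf0.
have l1 := phi_curvature_linear Y Z; have l3 := opp_linear (phi_curvature_linear Z Y).
have l2 := phi_comp_linear (curvature_linear3 LC Y Z).
rewrite traceD //; last exact: add_linear.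
rewrite traceD // traceN ?(trace_phi_curvature_skew Z Y); last exact: phi_curvature_linear.
lra.
Qed.

Variables (alpha beta : Cinf M).
Hypothesis etaEinstein : forall Y Z p,
  ricci nabla Y Z p = alpha p * g Y Z p + beta p * (eta Y p * eta Z p).

Lemma eta_einstein_sum p : alpha p + beta p = 1 - m%:R.
Proof.
have := ricci_xi xi p; rewrite etaEinstein metric_xi // acm_eta_xi Cinf1E; lra.
Qed.

Lemma trace_curvature_phiE Y Z p :
  trace (fun X => phi (Rm Y Z X)) p = 2 * (1 + beta p) * g Y (phi Z) p.
Proof.
rewrite trace_curvature_phi; have := ricci_phi Y Z p.
rewrite etaEinstein eta_phi // Cinf0E.
have -> : alpha p = 1 - m%:R - beta p by have := eta_einstein_sum p; lra.
move=> H; have -> : B Y Z p = (- 1 - beta p) * g Y (phi Z) p by move: H; lra.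
ring.
Qed.

Lemma star_ricciE X Y p :
  star_ricci K nabla X Y p = - (1 + beta p) * (g X Y p - eta X p * eta Y p).
Proof.
rewrite /star_ricci (_ : trace _ p = trace (fun Z => phi (Rm X (phi Y) Z)) p).
  rewrite trace_curvature_phiE acm_phi2 !metricE metric_xi // !CinfE.
  by rewrite mulrA mulrA mulVf ?pnatr_eq0 //; ring.
exact: (trace_comp p (curvature_linear3 LC X (phi Y)) phi_linear).
Qed.

Lemma phi_nabla_curvature_linear W X Y :
  linear (fun Z => phi (nabla W (Rm X Y Z) - Rm X Y (nabla W Z))).
Proof.
have l3 := curvature_linear3 LC X Y.
  apply: phi_comp_linear => a Z Z'; rewrite l3 !(nablaE LC).
  rewrite !(endoD _ _ l3) !(endoZ _ _ l3); vfield_ring.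
Qed.

(* Exterior derivative of the 2-form [rho (X, Y) = trace (phi \o Rm X Y)]. *)
Lemma trace_curvature_phi_derive W X Y p (t : Cinf M) :
  (forall q, t q = trace (fun Z => phi (Rm X Y Z)) q) ->
  W t p = trace (fun Z => phi (nabla W (Rm X Y Z) - Rm X Y (nabla W Z))) p +
    2 * (eta X p * g (phi W) Y p - eta Y p * g (phi W) X p).
Proof.
move=> tE; have l3 := curvature_linear3 LC X Y.
rewrite -(trace_derive W p LC (phi_comp_linear l3) tE).
have -> : (fun Z => nabla W (phi (Rm X Y Z)) - phi (Rm X Y (nabla W Z))) =
    (fun Z => phi (nabla W (Rm X Y Z) - Rm X Y (nabla W Z)) +
      (g (phi W) (Rm X Y Z) *: xi + - (eta (Rm X Y Z) *: phi W))).
  apply/funext => Z; rewrite (nabla_phi KM) phiD phiN; vfield_ring.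
have sm : scalar (fun Z => g (phi W) (Rm X Y Z)).
  by move=> a Z Z'; rewrite l3 metricDr metricZr.
have se : scalar (fun Z => eta (Rm X Y Z)) by move=> a Z Z'; rewrite l3 linearP.
have ln := phi_nabla_curvature_linear W X Y.
have l1 := rank1_linear xi sm; have l2 := rank1_linear (phi W) se.
rewrite traceD //; last by apply: add_linear => //; exact: opp_linear.
rewrite traceD //; last exact: opp_linear.
rewrite traceN // !trace_rank1 //.
(* Both rank-one traces coming from [nabla phi] equal [g (phi W) (Rm X Y xi)], hence the factor
   2. *)
rewrite -metric_xi // (curvature_skew LC) (curvature_xi LC) // !metricE !CinfE; ring.
Qed.

(* [rho = 2 * (1 + beta) * Phi] with [Phi (X, Y) = g X (phi Y)]; comparing [d rho]
   with the trace of the second Bianchi identity gives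
   [(d beta + 2 * beta * eta) /\ Phi = 0]. *)
Lemma d_beta_wedge W X Y p :
  (W beta + 2 * beta * eta W) p * g X (phi Y) p +
  (X beta + 2 * beta * eta X) p * g Y (phi W) p +
  (Y beta + 2 * beta * eta Y) p * g W (phi X) p = 0.
Proof.
pose t X Y : Cinf M := 2 * (1 + beta) * g X (phi Y).
have tE X' Y' q : t X' Y' q = trace (fun Z => phi (Rm X' Y' Z)) q.
  by rewrite trace_curvature_phiE /t !CinfE.
have lR A B : linear (fun Z => phi (Rm A B Z)).
  exact: phi_comp_linear (curvature_linear3 LC A B).
have E : W (t X Y) p + X (t Y W) p + Y (t W X) p =
    t (bracket W X) Y p + t (bracket X Y) W p + t (bracket Y W) X p +
    2 * (eta X p * g (phi W) Y p - eta Y p * g (phi W) X p) +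
    2 * (eta Y p * g (phi X) W p - eta W p * g (phi X) Y p) +
    2 * (eta W p * g (phi Y) X p - eta X p * g (phi Y) W p).
  rewrite (trace_curvature_phi_derive W p (tE X Y)).
  rewrite (trace_curvature_phi_derive X p (tE Y W)).
  rewrite (trace_curvature_phi_derive Y p (tE W X)).
  have B2 : trace (fun Z => phi (nabla W (Rm X Y Z) - Rm X Y (nabla W Z))) p +
      trace (fun Z => phi (nabla X (Rm Y W Z) - Rm Y W (nabla X Z))) p +
      trace (fun Z => phi (nabla Y (Rm W X Z) - Rm W X (nabla Y Z))) p =
      t (bracket W X) Y p + t (bracket X Y) W p + t (bracket Y W) X p.
    have lN := phi_nabla_curvature_linear.
    rewrite !tE -!traceD //; do ?[exact: lN|exact: lR|exact/add_linear/lN/lN|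
      exact/add_linear/lR/lR].
    by congr (trace _ p); apply/funext => Z; rewrite -!phiD (bianchi2 LC).
  by rewrite -B2; ring.
move: E; rewrite /t.
rewrite !vfM !vfD !vf1 !(nabla_metric LC) !(nabla_phi KM) !(bracketE LC).
rewrite !metricE !metric_phil !metric_xi // !CinfE !Cinf0E !Cinf1E.
have sk A C : g A (phi C) p = - g C (phi A) p.
  by rewrite Defs.metric_sym metric_phil.
rewrite (sk (nabla X W)) (sk (nabla Y X)) (sk (nabla W Y)) (sk W Y) (sk X W) (sk Y X).
lra.
Qed.

(* At a point, take [X] orthogonal to [xi], [W] and [phi W]: the identity for
   [(W, X, phi X)] then reduces to [(W beta + 2 * beta * eta W) * g X X = 0]. *)
Lemma d_beta W : (3 < m)%N -> W beta = - (2 * beta * eta W).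
Proof.
move=> m3; apply: CinfP => p.
pose l (j : 'I_3) : vfield M -> Cinf M :=
  if j == 0 :> nat then (eta : vfield M -> Cinf M)
  else if j == 1 :> nat then g ^~ W else g ^~ (phi W).
have sl j : scalar (l j).
  rewrite /l; case: ifP => _; first exact: eta_scalar.
  by case: ifP => _; exact: metric_linear.
have [X [Xp lX]] := exists_form_kernel p m3 sl.
have etaX : eta X p = 0 := lX (@Ordinal 3 0 isT).
have gXW : g X W p = 0 := lX (@Ordinal 3 1 isT).
have gXphiW : g X (phi W) p = 0 := lX (@Ordinal 3 2 isT).
have gXX : 0 < g X X p by exact: metric_pos.
have := d_beta_wedge W X (phi X) p.
rewrite acm_phi2 !metricE metric_xi // (acm_compat K X W).
rewrite (Defs.metric_sym g W (phi X)) metric_phil.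
rewrite !CinfE !Cinf1E gXphiW etaX gXW.
move=> H; have {}H : (W beta p + 2 * beta p * eta W p) * g X X p = 0 by move: H; lra.
by have /eqP := H; rewrite mulf_eq0 (gt_eqF gXX) orbF addr_eq0 => /eqP ->.
Qed.

End KenmotsuRicci.

(** * The soliton equation *)

Section Soliton.
Context {R : realType} {m : nat} {M : manifold R m}.
Variables (K : almost_contact_metric M) (nabla : vfield M -> vfield M -> vfield M).
Hypotheses (LC : levi_civita (acm_metric K) nabla) (KM : kenmotsu K nabla).
Hypothesis m3 : (3 < m)%N.
Implicit Types (X Y Z W : vfield M) (a f : Cinf M) (p : M).
Local Notation Rm := (curvature nabla).
Local Notation phi := (acm_phi K).
Local Notation xi := (acm_xi K).
Local Notation eta := (acm_eta K).
Local Notation g := (acm_metric K).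

(** Used with [xi] and the soliton field, whose Lie derivatives of [g] are both expressible by [g],
    [eta] and [beta]. *)
Lemma lie_derivative_bracket V W X Y :
  lie_derivative (bracket V W) g X Y =
  lie_derivative V (lie_derivative W g) X Y - lie_derivative W (lie_derivative V g) X Y.
Proof.
have J A B C : bracket (bracket A B) C = bracket A (bracket B C) - bracket B (bracket A C).
  by vfield_ring.
rewrite /lie_derivative !J !metricE bracket_fun; vf_simp; ring.
Qed.

Lemma lie_metric V X Y :
  lie_derivative V g X Y = g (nabla X V) Y + g X (nabla Y V).
Proof.
rewrite /lie_derivative (nabla_metric LC) !(bracketE LC) !metricE; ring.
Qed.

Lemma lie_xi_metric X Y : lie_derivative xi g X Y = 2 * (g X Y - eta X * eta Y).
Proof.
rewrite lie_metric !(nabla_xi LC) // !metricE metric_xi // metric_xil //; ring.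
Qed.

Lemma eta_closed X Y : X (eta Y) - Y (eta X) - eta (bracket X Y) = 0.
Proof.
by rewrite !(nabla_eta LC) // (bracketE LC) !etaE (Defs.metric_sym g Y X); ring.
Qed.

Variables (alpha beta : Cinf M).
Hypothesis etaEinstein : forall Y Z p,
  ricci nabla Y Z p = alpha p * g Y Z p + beta p * (eta Y p * eta Z p).
Variables (V : vfield M) (lambda : R).
Hypothesis soliton : forall X Y p,
  lie_derivative V g X Y p + 2 * star_ricci K nabla X Y p + 2 * lambda * g X Y p = 0.

Let l : Cinf M := Cinf_cst M lambda.

Lemma soliton_lie X Y : lie_derivative V g X Y =
  2 * (1 + beta) * (g X Y - eta X * eta Y) - 2 * l * g X Y.
Proof.
apply: CinfP => p; have := soliton X Y p.
rewrite (star_ricciE LC KM etaEinstein) !CinfE !Cinf1E Cinf_cstE; lra.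
Qed.

Let G := bracket xi V.
Let u := eta V.

(** The soliton equation at [(X, xi)], where [g - eta eta] vanishes; closedness of [eta] turns
    [eta (bracket V X)] into [V (eta X) - X u]. *)
Lemma metric_G X : g G X = - X u - 2 * l * eta X.
Proof.
have := soliton_lie X xi; rewrite /lie_derivative !metric_xi // acm_eta_xi.
rewrite (bracketNC LC V xi) metricNr -/G (Defs.metric_sym g X G).
have := eta_closed V X; rewrite -/u => /eqP; rewrite subr_eq add0r => /eqP <- H.
rewrite -[LHS](addrK (X u)) -[X in X - _]opprK; apply/eqP.
rewrite -subr_eq0; apply/eqP.
transitivity (V (eta X) - (V (eta X) - X u) - - g G X -
    (2 * (1 + beta) * (eta X - eta X * 1) - 2 * l * eta X)).
  by ring.
by rewrite H subrr.
Qed.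

Lemma eta_G : eta G = - l.
Proof.
have := soliton_lie xi xi; rewrite /lie_derivative !metric_xi // !metric_xil // acm_eta_xi.
rewrite (bracketNC LC V xi) etaN -/G vf1 // => H.
apply: CinfP => p; have := congr1 (fun f : Cinf M => f p) H.
by rewrite !CinfE !Cinf1E ?Cinf0E; lra.
Qed.

(** Along [xi], [g - eta eta] is reproduced with factor 2, so the terms in [1 + beta] cancel in the
    commutator. What remains comes from [xi beta = - 2 beta], from [lambda], and from
    [L_V eta = d u]. *)
Lemma lie_G X Y : lie_derivative G g X Y =
  - (4 * beta * (g X Y - eta X * eta Y)) + 4 * l * eta X * eta Y +
  2 * (X u * eta Y + eta X * Y u).
Proof.
have etaV Z : eta (bracket V Z) = V (eta Z) - Z u.
  by apply/eqP; rewrite eq_sym -subr_eq0 /u eta_closed.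
rewrite /G lie_derivative_bracket.
have -> : lie_derivative V g =
    (fun X Y => 2 * (1 + beta) * (g X Y - eta X * eta Y) - 2 * l * g X Y).
  by apply/funext => X'; apply/funext => Y'; exact: soliton_lie.
have -> : lie_derivative xi g = (fun X Y => 2 * (g X Y - eta X * eta Y)).
  by apply/funext => X'; apply/funext => Y'; exact: lie_xi_metric.
have hV : V (g X Y) = 2 * (1 + beta) * (g X Y - eta X * eta Y) - 2 * l * g X Y +
    g (bracket V X) Y + g X (bracket V Y).
  by rewrite -soliton_lie /lie_derivative; ring.
have hxi : xi (g X Y) = 2 * (g X Y - eta X * eta Y) +
    g (bracket xi X) Y + g X (bracket xi Y).
  by rewrite -lie_xi_metric /lie_derivative; ring.
have etaxi Z : eta (bracket xi Z) = xi (eta Z).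
  by have /eqP := eta_closed xi Z; rewrite acm_eta_xi vf1 // subr0 subr_eq0 => /eqP <-.
have db : xi beta = - (2 * beta) by rewrite (d_beta LC KM etaEinstein) // acm_eta_xi mulr1.
rewrite /lie_derivative; do 3 rewrite ?vfD ?vfN ?vfM.
rewrite !vfC !vf1 hV hxi !etaV !etaxi db; ring.
Qed.

Lemma metric_ext X Y : (forall Z, g X Z = g Y Z) -> X = Y.
Proof.
move=> XY; apply/eqP; rewrite -subr_eq0; apply/eqP/(metric_eq0 (g := g)).
by rewrite metricDl metricNl XY subrr.
Qed.

Lemma Cinf_double_inj f a : f + f = a + a -> f = a.
Proof.
move=> fa; apply: CinfP => p; have := congr1 (fun f : Cinf M => f p) fa.
by rewrite !CinfDE; lra.
Qed.

(* [G] is dual to the closed form [- d u - 2 * l * eta], so [nabla G] is half of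
   [lie_derivative G g]. *)
Lemma nabla_G X : nabla X G =
  - (2 * beta) *: (X - eta X *: xi) + X u *: xi - eta X *: G.
Proof.
apply: metric_ext => Y; apply: Cinf_double_inj.
have uE : Y u = - g G Y - 2 * l * eta Y by rewrite metric_G; ring.
have skew0 : g (nabla X G) Y - g (nabla Y G) X = 0.
  have : X (g G Y) - Y (g G X) - g G (bracket X Y) = 0.
    rewrite !metric_G bracket_fun; do 3 rewrite ?vfD ?vfN ?vfM.
    rewrite !vfC !vf1.
    have /eqP := eta_closed X Y; rewrite subr_eq0 => /eqP <-; ring.
  rewrite !(nabla_metric LC) (bracketE LC) !metricE => <-; ring.
have sum := lie_metric G X Y.
rewrite lie_G uE (Defs.metric_sym g X (nabla Y G)) in sum.
transitivity ((g (nabla X G) Y + g (nabla Y G) X) + (g (nabla X G) Y - g (nabla Y G) X)).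
  by ring.
rewrite skew0 -sum !metricE metric_xil //; ring.
Qed.

(** Since [eta G = - l], this is the component of [G] orthogonal to [xi]. *)
Let H := G + l *: xi.

Lemma eta_H : eta H = 0.
Proof. by rewrite /H etaD etaZ eta_G acm_eta_xi mulr1 addNr. Qed.

(** [metric_G] replaces [X u] by [- g G X - 2 * l * eta X], so the equation closes up in [H] and no
    longer involves [u]. *)
Lemma nabla_H X : nabla X H =
  (l - 2 * beta) *: (X - eta X *: xi) - g H X *: xi - eta X *: H.
Proof.
rewrite /H (nablaDr LC) (nablaZr LC) nabla_G (nabla_xi LC) // vfC.
rewrite metricDl metricZl metric_xil //.
rewrite metric_G; vfield_ring.
Qed.

(** The coefficient [l - 2 * beta] has differential [4 * beta * eta], which exactly cancels the
    contribution of [beta] itself; hence only [l] survives in the curvature. *)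
Lemma curvature_concircular Z X Y :
  (forall W, nabla W Z =
     (l - 2 * beta) *: (W - eta W *: xi) - g Z W *: xi - eta W *: Z) ->
  Rm X Y Z = 2 * l *: (eta X *: Y - eta Y *: X) - g Z Y *: X + g Z X *: Y.
Proof.
move=> nZ; have dm W : W (l - 2 * beta) = 4 * beta * eta W.
  by rewrite vfD vfN vfM vfD vfC !vf1 (d_beta LC KM etaEinstein) //; ring.
rewrite /curvature !nZ !(nablaE LC) !nZ !(nabla_xi LC) // !dm.
rewrite !(nabla_metric LC) !nZ !(nabla_eta LC) // !(bracketE LC) !etaE !metricE !metric_xil //.
rewrite (Defs.metric_sym g Y X); vfield_ring.
Qed.

Lemma concircular_annihilated Z :
  (forall W, nabla W Z =
     (l - 2 * beta) *: (W - eta W *: xi) - g Z W *: xi - eta W *: Z) ->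
  beta *: Z = 0 ->
  forall X, (beta * (l - 2 * beta)) *: (X - eta X *: xi) = 0.
Proof.
move=> nZ bZ X; have := congr1 (nabla X) bZ.
rewrite (nablaZr LC) (nabla0r LC) nZ (d_beta LC KM etaEinstein) // => E.
have gZ : beta * g Z X = 0 by rewrite -metricZl bZ -(scale0r xi) metricZl mul0r.
apply: vfield_eq => f; rewrite vf0E.
have := congr1 (fun Y : vfield M => Y f) E; have := congr1 (fun Y : vfield M => Y f) bZ.
vf_simp => bZf Ef.
(* The coefficient 3 collects two copies of [eta X * (beta * Z f)] from the derivative of [beta] and
   one from [nabla X Z]; all are zero because [beta *: Z = 0]. *)
have := congr1 (fun e => e + 3 * eta X * (beta * Z f) + beta * g Z X * xi f) Ef.
by rewrite [RHS]/= [in RHS]bZf [in RHS]gZ mulr0 mul0r !addr0 => <-; ring.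
Qed.

Lemma ricci_H Y p : ricci nabla Y H p = (1 - m%:R) * (2 * lambda * eta Y p + g H Y p).
Proof.
rewrite /ricci.
have -> : (fun X => Rm X Y H) = (fun X => (2 * l * eta X + g H X) *: Y +
    - ((2 * l * eta Y + g H Y) *: X)).
  by apply/funext => X; rewrite (curvature_concircular X Y nabla_H); vfield_ring.
have s1 : scalar (fun X => 2 * l * eta X + g H X).
  by move=> a X Z; rewrite !etaE metricDr metricZr; ring.
have l1 := rank1_linear Y s1.
have l2 : linear (fun X => (2 * l * eta Y + g H Y) *: X) by exact: (@scale_linear _ _ _ _ id).
rewrite traceD //; last exact: opp_linear.
rewrite traceN // trace_rank1 // (traceZ _ (F := id)) // trace_id.
rewrite !CinfE !Cinf1E Cinf_cstE; ring.
Qed.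

Lemma dim_neq1 : (m%:R - 1 : R) != 0.
Proof. by rewrite subr_eq0 pnatr_eq1; apply: contraTneq m3 => ->. Qed.

(** At [Y = xi] the eta-Einstein side vanishes because [H] is orthogonal to [xi], leaving
    [2 * (1 - m) * lambda = 0]. A point is an argument because on an empty manifold nothing
    constrains [lambda]. *)
Lemma soliton_lambda0 p : lambda = 0.
Proof.
have := ricci_H xi p.
rewrite etaEinstein metric_xil // (Defs.metric_sym g H) metric_xil // eta_H acm_eta_xi.
rewrite !Cinf0E !Cinf1E => E.
have : (m%:R - 1) * lambda = 0 by move: E; lra.
by move/eqP; rewrite mulf_eq0 (negbTE dim_neq1) => /eqP.
Qed.

Lemma soliton_beta0 : beta = 0.
Proof.
(* At [Y = H] the two values of the Ricci tensor give [(1 - m - alpha) * g H H = 0], that is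
   [beta * g H H = 0]. One more factor [beta] turns this into the squared length of [beta *: H]. *)
have bH : beta *: H = 0.
  apply: (metric_eq0 (g := g)); rewrite metricZl metricZr; apply: CinfP => p.
  have := ricci_H H p; rewrite etaEinstein eta_H (soliton_lambda0 p).
  have := eta_einstein_sum LC KM etaEinstein p.
  rewrite !CinfE !Cinf0E => E1 E2.
  have -> : beta p * g H H p = 0.
    have -> : beta p = 1 - m%:R - alpha p by move: E1; lra.
    move: E2; lra.
  by rewrite mulr0.
have b2 := concircular_annihilated nabla_H bH.
apply: CinfP => p.
(* The projection [X - eta X *: xi] has trace [m - 1], which is nonzero; with [lambda = 0] the
   scalar factor is [- 2 * beta ^+ 2]. *)
have : trace (fun X => (beta * (l - 2 * beta)) *: (X - eta X *: xi)) p = 0.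
  by rewrite -(trace0 (M := M) p); congr (trace _ p); apply/funext => X.
have l1 := rank1_linear xi (eta_scalar K).
have lid : linear (fun X : vfield M => X) by [].
rewrite traceZ; last by apply: add_linear => //; exact: opp_linear.
rewrite traceB // trace_id trace_rank1; last exact: eta_scalar.
rewrite acm_eta_xi Cinf1E => /eqP; rewrite mulf_eq0 (negbTE dim_neq1) orbF.
rewrite !CinfE !Cinf1E Cinf_cstE (soliton_lambda0 p) sub0r mulrN oppr_eq0.
by rewrite !mulf_eq0 -[1 + 1]/(2%:R) pnatr_eq0 orbb => /eqP.
Qed.

Lemma soliton_einstein : einstein g nabla.
Proof.
exists (1 - m%:R) => Y Z p; rewrite etaEinstein -(eta_einstein_sum LC KM etaEinstein p).
by rewrite soliton_beta0 Cinf0E mul0r !addr0.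
Qed.

End Soliton.

Local Close Scope ring_scope.
Local Close Scope classical_set_scope.
Unset Implicit Arguments.

Theorem theorem3p2 (R : realType) (n : nat) (M : manifold R (2 * n + 1))
    (K : almost_contact_metric M)
    (nabla : vfield M -> vfield M -> vfield M)
    (dim_gt3 : (3 < 2 * n + 1)%N)
    (nabla_LC : levi_civita (acm_metric K) nabla)
    (K_kenmotsu : kenmotsu K nabla)
    (K_eta_einstein : eta_einstein K nabla)
    (K_soliton : star_ricci_soliton K nabla) :
  einstein (acm_metric K) nabla.
Proof.
have [alpha [beta S_eq]] := K_eta_einstein.
have [V [lambda sol]] := K_soliton.
exact: (soliton_einstein nabla_LC K_kenmotsu dim_gt3 S_eq sol).
Qed.
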